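(* Let $n\ge 1$ and $d\geq 1$ be integers. There exists a shellable polyhedral cell complex $P_d(x_1,\dots,x_n)$ that supports a minimal free resolution of the ideal $(x_1,\dots,x_n)^d\subset S=\Bbbk[x_1,\dots,x_n]$. Moreover, $P_d(x_1,\dots,x_n)$ is a polyhedral subdivision of the $(n-1)$-simplex $\Delta_{n-1}(x_1^d,x_2^d,\dots,x_n^d)$.
   Context: $\Bbbk$ is a field with $\operatorname{char}(\Bbbk)=0$, $S=\Bbbk[x_1,\dots,x_n]$. For a monomial ideal $I$, $G(I)$ denotes its unique minimal set of monomial generators. For a monomial $\mathbf m=x_1^{a_1}\cdots x_n^{a_n}$, $e(\mathbf m)=(a_1,\dots,a_n)$. A polyhedral cell complex is a nonempty finite collection $X$ of convex polytopes (called faces) in some $\mathbb R^N$ such that every face of a polytope in $X$ is in $X$, and the intersection of any two polytopes in $X$ is a face of both. It is in particular a regular cell complex. Cellular resolutions: let $X$ be a regular cell complex whose vertices are labelled bijectively by the elements of $G(I)$. Each nonempty face $F$ is labelled by $\mathbf m_F$, the least common multiple of the labels of its vertices, and has degree $e(\mathbf m_F)$. Let $\epsilon_X$ be an incidence function on $X$ (with values $\pm1$ on pairs $(F,F')$ with $F'$ a codimension-one face of $F$, and $0$ otherwise). The cellular complex $\mathbf F_X$ is the $\mathbb Z^n$-graded free $S$-module $\bigoplus_{\varnothing\ne F\in X}SF$, with $F$ in degree $e(\mathbf m_F)$ and in homological degree $\dim F$, with differential $\partial F=\sum_{\varnothing\neq F'\in X}\epsilon_X(F,F')\frac{\mathbf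 m_F}{\mathbf m_{F'}}F'$. One says $X$ supports a (minimal) free resolution of $I$ if $\mathbf F_X$ is a (minimal) free resolution of $I$. $\Delta_{n-1}(x_1^d,\dots,x_n^d)$ denotes the $(n-1)$-simplex whose vertices are labelled by $x_1^d,\dots,x_n^d$; a polyhedral subdivision of it is a polyhedral cell complex whose faces have union equal to this simplex (the corners of the simplex being the vertices of the complex with labels $x_1^d,\dots,x_n^d$). Shellable is meant in the usual sense for pure polytopal complexes: the maximal faces can be ordered $F_1,\dots,F_t$ (a shelling) such that either they are all points, or the boundary complex of $F_1$ has a shelling and for every $1<j\le t$ the set $F_j\cap(F_1\cup\dots\cup F_{j-1})$ is nonempty and is the union of an initial segment of the maximal faces in some shelling of the boundary complex of $F_j$. *)

(* Defs.v *)
From HB Require Import structures.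
From mathcomp Require Import all_boot all_order all_algebra finmap.
From mathcomp Require Import boolp classical_sets functions reals.
From mathcomp Require Import mpoly.

Set Implicit Arguments.
Unset Strict Implicit.
Unset Printing Implicit Defensive.

Import Order.TTheory GRing.Theory Num.Theory.

Local Open Scope classical_set_scope.
Local Open Scope ring_scope.

Section Polytopes.
Variables (R : realType) (N : nat).
Local Notation V := 'rV[R]_N.

(* Indexed by a possibly empty finite type, so that set0 is a polytope. *)
Definition conv_hull (I : finType) (p : I -> V) : set V :=
  [set x | exists a : I -> R,
     [/\ forall i, 0 <= a i, \sum_i a i = 1 & x = \sum_i a i *: p i]].

Definition is_polytope (P : set V) : Prop :=
  exists (m : nat) (p : 'I_m -> V), P = conv_hull p.

(* The case c = 0 gives the improper faces: P itself (b = 0) and the empty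
   face (b > 0). *)
Definition is_face (F P : set V) : Prop :=
  exists (c : 'cV[R]_N) (b : R),
    (forall x, P x -> (x *m c) 0 0 <= b) /\
    F = P `&` [set x | (x *m c) 0 0 = b].

Definition affinely_independent (I : finType) (p : I -> V) : Prop :=
  forall a : I -> R,
    \sum_i a i = 0 -> \sum_i a i *: p i = 0 -> forall i, a i = 0.

(* Affine dimension, with affdim set0 = -1; at most N.+1 points of R^N are
   affinely independent. *)
Definition affdim (A : set V) : int :=
  (\max_(m < N.+2 | `[< exists p : 'I_m -> V,
      (forall i, A (p i)) /\ affinely_independent p >]) (m : nat))%N%:Z - 1.

Definition is_facet (G F : set V) : Prop :=
  is_face G F /\ affdim F = affdim G + 1.

Definition polyhedral_cell_complex (X : {fset (set V)}) : Prop :=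
  [/\ X != fset0,
      forall P, P \in X -> is_polytope P,
      forall P F, P \in X -> is_face F P -> F \in X &
      forall P Q, P \in X -> Q \in X ->
        is_face (P `&` Q) P /\ is_face (P `&` Q) Q].

Definition boundary_complex (P : set V) : set (set V) :=
  [set F | is_face F P /\ F <> P].

Definition maximal_faces (C : set (set V)) : set (set V) :=
  [set F | C F /\ forall G, C G -> F `<=` G -> G = F].

(* s is a shelling of the pure k-dimensional complex C. *)
Fixpoint shelling (k : nat) (C : set (set V)) (s : seq (set V)) : Prop :=
  [/\ uniq s, [set` s] = maximal_faces C,
      forall F, F \in s -> affdim F = k%:Z &
      if k is k'.+1 then
        (exists t, shelling k' (boundary_complex (nth set0 s 0)) t) /\
        forall j : nat, (0 < j < size s)%N ->
          let D := nth set0 s j `&`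
                   \bigcup_(i in [set i : nat | (i < j)%N]) nth set0 s i in
          D !=set0 /\
          exists (t : seq (set V)) (r : nat),
            shelling k' (boundary_complex (nth set0 s j)) t /\
            D = \bigcup_(G in [set` take r t]) G
      else True].

Definition shellable (X : {fset (set V)}) : Prop :=
  exists (k : nat) (s : seq (set V)), shelling k [set` X] s.

Definition vertices (X : {fset (set V)}) : set (set V) :=
  [set P | P \in X /\ affdim P = 0].

(* The empty face takes part: e F set0 is nonzero exactly for 0-cells F. *)
Definition incidence_function (X : {fset (set V)})
    (e : set V -> set V -> int) : Prop :=
  [/\ forall F G, F \in X -> G \in X -> is_facet G F ->
        e F G = 1 \/ e F G = -1,
      forall F G, F \in X -> G \in X -> ~ is_facet G F -> e F G = 0,
      forall P, vertices X P -> e P set0 = 1 &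
      forall F F1 F2 G, F \in X -> F1 <> F2 ->
        is_facet F1 F -> is_facet F2 F -> is_facet G F1 -> is_facet G F2 ->
        e F F1 * e F1 G + e F F2 * e F2 G = 0].

End Polytopes.

Section MonomialIdeals.
Variables (K : fieldType) (n : nat).
Local Notation S := {mpoly K[n]}.

Definition ideal_gen (A : set S) : set S :=
  [set f | exists (m : nat) (a g : 'I_m -> S),
     (forall i, A (g i)) /\ f = \sum_i a i * g i].

Definition ideal_exp (I : set S) (d : nat) : set S :=
  ideal_gen [set f | exists g : 'I_d -> S,
                       (forall i, I (g i)) /\ f = \prod_i g i].

Definition maxideal : set S := ideal_gen [set 'X_i | i in [set: 'I_n]].

Definition monomial_ideal (G : set 'X_{1..n}) : set S :=
  ideal_gen [set 'X_[m] | m in G].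

Definition min_monomial_generators (I : set S) (G : set 'X_{1..n}) : Prop :=
  monomial_ideal G = I /\
  forall H : set 'X_{1..n}, H `<=` G -> monomial_ideal H = I -> H = G.

End MonomialIdeals.

Arguments maxideal : clear implicits.

Section CellularComplex.
Variables (R : realType) (N : nat) (K : fieldType) (n : nat).
Local Notation V := 'rV[R]_N.
Local Notation S := {mpoly K[n]}.
Variables (X : {fset (set V)}).

(* Only the values of lab at the vertices of X are used. *)
Variables (lab : set V -> 'X_{1..n}) (e : set V -> set V -> int).

Definition label (F : set V) : 'X_{1..n} :=
  \big[@mlcm n/0%MM]_(P : X | `[< affdim (val P) = 0 /\ is_face (val P) F >])
    lab (val P).

Definition cell (i : nat) : finType := {F : X | affdim (val F) == i%:Z}.

Definition cell_set (i : nat) (F : cell i) : set V := val (val F).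

Definition chain (i : nat) := {ffun cell i -> S}.

(* The coefficient of G in the differential of F.  The subtraction of
   exponents is truncated, but label G divides label F whenever G is a face
   of F, and the sign vanishes otherwise. *)
Definition bdry_coef (F G : set V) : S :=
  (e F G)%:~R * 'X_[label F - label G].

Definition bdry (i : nat) (f : chain i.+1) : chain i :=
  [ffun G : cell i => \sum_(F : cell i.+1)
     f F * bdry_coef (cell_set F) (cell_set G)].

Definition augmentation (f : chain 0) : S :=
  \sum_(P : cell 0) f P * 'X_[label (cell_set P)].

Definition free_resolution (I : set S) : Prop :=
  [/\ range augmentation = I,
      [set f | augmentation f = 0] = range (@bdry 0) &
      forall i, [set f | @bdry i f = 0] = range (@bdry i.+1)].

(* The differentials map F_{i+1} into m F_i, where m = (x_1, ..., x_n). *)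
Definition minimal_differential : Prop :=
  forall (i : nat) (f : chain i.+1) (G : cell i), maxideal K n (bdry f G).

End CellularComplex.

Definition labelled_by_generators (R : realType) (N : nat) (K : fieldType)
    (n : nat) (X : {fset (set 'rV[R]_N)}) (lab : set 'rV[R]_N -> 'X_{1..n})
    (I : set {mpoly K[n]}) : Prop :=
  exists2 G, min_monomial_generators I G & set_bij (vertices X) G lab.

(* An incidence function is unique up to changing the orientations of the
   cells, so the choice is immaterial; existence is included so that the
   last clause is not vacuous. *)
Definition supports_minimal_resolution (R : realType) (N : nat)
    (K : fieldType) (n : nat) (X : {fset (set 'rV[R]_N)})
    (lab : set 'rV[R]_N -> 'X_{1..n}) (I : set {mpoly K[n]}) : Prop :=
  [/\ labelled_by_generators X lab I,
      exists e, incidence_function X e &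
      forall e, incidence_function X e ->
        free_resolution X lab e I /\ minimal_differential K X lab e].

(* X subdivides a simplex with n vertices whose corners are vertices of X
   labelled by x_1^d, ..., x_n^d. *)
Definition subdivides_power_simplex (R : realType) (N n : nat) (d : nat)
    (X : {fset (set 'rV[R]_N)}) (lab : set 'rV[R]_N -> 'X_{1..n}) : Prop :=
  exists c : 'I_n -> 'rV[R]_N,
    [/\ affinely_independent c,
        \bigcup_(F in [set` X]) F = conv_hull c &
        forall i, [set c i] \in X /\ lab [set c i] = (U_(i) *+ d)%MM].

(* Main.v *)
(** The complex is the mixed subdivision of the dilated simplex d * Delta_(n-1)
    that corresponds to the staircase triangulation of Delta_(d-1) x Delta_(n-1).
    A cell is a Minkowski sum of faces Delta_(X_0) + ... + Delta_(X_(d-1)), where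
    the X_j are nonempty subsets of the n corners, every element of X_i being at
    most every element of X_j for i < j; it is encoded by the "box"
    {(j, v) | v in X_j}, and has dimension |box| - d.

    Reading a point of d * Delta_(n-1) as a mass distribution on 0, ..., n - 1 and
    cutting the total mass d into unit pieces from left to right decomposes it in
    a unique way as an ordered sum, so that cells intersect as their boxes do and
    cover the simplex.  The label of a cell has degree |box|, hence the minimality.

    Exactness is checked in each multidegree b.  If g is the smallest monomial of
    degree d dividing x^b, a cycle is pushed, one row after the other, into boxes
    whose first rows are the singletons {g_j}: a box with X_j <> {g_j} is matched
    with the one obtained by adding g_j to, or deleting it from, X_j.  Only the
    anticommuting squares of the incidence function are used.

    Facets of a product of simplices are the pairs (j, v) with |X_j| > 1.  Any
    order whose first and last elements lie in the same row shells its boundary.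
    The maximal cells are lattice paths; ordered by area, each of them meets the
    previous ones in the facets given by its corners. *)
From mathcomp Require Import all_boot all_order all_algebra finmap.
From mathcomp Require Import mpoly zify ring lra.

Set Implicit Arguments.
Unset Strict Implicit.
Unset Printing Implicit Defensive.

Import Order.TTheory GRing.Theory Num.Theory.

Local Open Scope ring_scope.

(** * Boxes *)

Section Boxes.
Variables (d n : nat).
Local Notation box := {set 'I_d * 'I_n}.
Implicit Types (A B Z : box) (p q : 'I_d * 'I_n) (j : 'I_d) (v : 'I_n).

(** The contraction stays inside one multidegree because the greedy vertex is leftmost: a box whose
    label divides x^b and that contains (j, v) has at least j + 1 elements in columns up to v, and
    the exponents of b must accommodate them. Hence g_j is at most every element of row j. Adding
    g_j to row j keeps the rows ordered and, as the earlier rows are already greedy, does not exceed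
    the exponent of b. Exactness is demanded for every incidence function, so no explicit sign can
    enter the contraction: its coefficients are values of the incidence function itself, whose
    squares are 1. Explicit signs serve only to show that some incidence function exists. A box is
    one set of pairs rather than a tuple of row sets. Facets are then deletions of single pairs, and
    chains are functions on one finite type, zero off the valid boxes. As d is positive, the empty
    face corresponds to the empty box; its normalisation is what gives the two ends of an edge
    opposite signs, and so makes the augmentation kill boundaries. *)

Definition sorted_box A : bool :=
  [forall p in A, forall q in A, (p.1 < q.1)%N ==> (p.2 <= q.2)%N].

Definition full_box A : bool := [forall j, exists v, (j, v) \in A].

Definition valid_box A : bool := sorted_box A && full_box A.

Lemma sorted_boxP A :
  reflect (forall p q, p \in A -> q \in A -> (p.1 < q.1)%N -> (p.2 <= q.2)%N)
          (sorted_box A).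
Proof.
apply: (iffP forall_inP) => [h p q pA qA|h p pA].
  by have /forall_inP/(_ q qA)/implyP := h p pA.
by apply/forall_inP => q qA; apply/implyP; apply: h.
Qed.

Lemma full_boxP A : reflect (forall j, exists v, (j, v) \in A) (full_box A).
Proof.
by apply: (iffP forallP) => h j; [apply/existsP | apply/existsP]; apply: h.
Qed.

Lemma sorted_boxS A B : B \subset A -> sorted_box A -> sorted_box B.
Proof.
move=> /subsetP sBA /sorted_boxP sA; apply/sorted_boxP => p q /sBA pA /sBA qA.
exact: sA.
Qed.

Lemma full_boxS A B : A \subset B -> full_box A -> full_box B.
Proof.
by move=> /subsetP s /full_boxP f; apply/full_boxP => j; have [v /s] := f j; exists v.
Qed.

Lemma valid_between A B Z :
  valid_box A -> A \subset B -> B \subset Z -> valid_box Z -> valid_box B.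
Proof.
move=> /andP[_ fA] sAB sBZ /andP[sZ _].
by rewrite /valid_box (sorted_boxS sBZ sZ) (full_boxS sAB fA).
Qed.

Definition facet_points A : box :=
  [set p in A | [exists q in A, (q != p) && (q.1 == p.1)]]%SET.

Lemma facet_pointsP A p :
  reflect (p \in A /\ exists2 q, q \in A & q != p /\ q.1 = p.1)
          (p \in facet_points A).
Proof.
rewrite inE; apply: (iffP andP) => -[pA].
  by case/exists_inP=> q qA /andP[qp /eqP e]; split=> //; exists q.
move=> [q qA [qp e]]; split=> //; apply/exists_inP; exists q => //.
by rewrite qp e eqxx.
Qed.

Lemma facet_points_sub A p : p \in facet_points A -> p \in A.
Proof. by case/facet_pointsP. Qed.

Lemma valid_boxD1 A p :
  valid_box A -> p \in A -> valid_box (A :\ p) = (p \in facet_points A).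
Proof.
move=> /andP[sA /full_boxP fA] pA; apply/idP/facet_pointsP.
  case/andP=> _ /full_boxP/(_ p.1)[v]; rewrite in_setD1 => /andP[ne vA].
  by split=> //; exists (p.1, v).
move=> [_ [q qA [qp e]]]; rewrite /valid_box (sorted_boxS (subD1set _ _) sA).
apply/full_boxP => j; case: (eqVneq j p.1) => [->|jp].
  by exists q.2; rewrite -e -surjective_pairing in_setD1 qp.
have [v vA] := fA j; exists v; rewrite in_setD1 vA andbT.
by apply: contraNneq jp => <-.
Qed.

Lemma facet_pointsS A B p :
  B \subset A -> p \in facet_points B -> p \in facet_points A.
Proof.
move=> /subsetP sBA /facet_pointsP[/sBA pA [q /sBA qA qp]].
by apply/facet_pointsP; split => //; exists q.
Qed.

Definition sel_box (m : 'I_d -> 'I_n) : box := [set p | p.2 == m p.1]%SET.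

Lemma in_sel_box m j v : ((j, v) \in sel_box m) = (v == m j).
Proof. by rewrite inE. Qed.

Lemma sel_boxE m : sel_box m = [set (j, m j) | j in 'I_d]%SET.
Proof.
apply/setP=> -[j v]; rewrite in_sel_box; apply/eqP/imsetP => [->|[i _ [-> ->]]//].
by exists j.
Qed.

Lemma card_sel_box m : #|sel_box m| = d.
Proof. by rewrite sel_boxE card_imset ?card_ord // => i j [->]. Qed.

Lemma full_sel_box m : full_box (sel_box m).
Proof. by apply/full_boxP => j; exists (m j); rewrite in_sel_box. Qed.

(* The choice of [v] whenever possible realises the exponent of [x_v] in the
   least common multiple of the vertex labels of a box. *)
Lemma full_box_sel A v : full_box A ->
  exists m, sel_box m \subset A /\ forall j, (j, v) \in A -> m j = v.
Proof.
move=> /full_boxP fA.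
pose m j := if (j, v) \in A then v else xchoose (fA j).
exists m; split; last by move=> j jA; rewrite /m jA.
apply/subsetP => -[j u]; rewrite in_sel_box => /eqP ->; rewrite /m.
by case: ifP => // _; exact: (xchooseP (fA j)).
Qed.

Lemma full_box_sel_through A p : full_box A -> p \in A ->
  exists m, sel_box m \subset A /\ m p.1 = p.2.
Proof.
move=> fA pA; have [m [mA h]] := full_box_sel p.2 fA; exists m; split => //.
by apply: h; rewrite -surjective_pairing.
Qed.

Lemma valid_sel_box A m : valid_box A -> sel_box m \subset A -> valid_box (sel_box m).
Proof. by move=> /andP[sA _] /sorted_boxS/(_ sA) s;
  rewrite /valid_box s full_sel_box. Qed.

Lemma valid_const_box v : valid_box (sel_box (fun=> v)).
Proof.
rewrite /valid_box full_sel_box andbT; apply/sorted_boxP => p q.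
by rewrite !inE => /eqP -> /eqP ->.
Qed.

Lemma valid_box_sel A :
  valid_box A -> exists2 m, sel_box m \subset A & valid_box (sel_box m).
Proof.
move=> vA; have [_ /full_boxP fA] := andP vA.
pose m j := xchoose (fA j).
have mA : sel_box m \subset A.
  by apply/subsetP => -[j u]; rewrite in_sel_box => /eqP ->; exact: (xchooseP (fA j)).
by exists m => //; apply: valid_sel_box vA mA.
Qed.

Lemma card_valid_box A : valid_box A -> (d <= #|A|)%N.
Proof.
by case/valid_box_sel => m /subset_leq_card; rewrite card_sel_box.
Qed.

Lemma card_full_box_sel A m : sel_box m \subset A -> #|A| = d -> A = sel_box m.
Proof.
move=> mA cA; apply/esym/eqP; rewrite eqEcard mA cA card_sel_box leqnn //.
Qed.

Lemma facet_pointsE A m : sel_box m \subset A ->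
  (facet_points A == set0) = (#|A| == d).
Proof.
move=> mA; apply/eqP/eqP => [f0|/(card_full_box_sel mA) ->]; last first.
  apply/setP=> -[j v]; rewrite in_set0; apply/negbTE/negP.
  case/facet_pointsP; rewrite in_sel_box => /eqP -> [[i u]].
  by rewrite in_sel_box /= => /eqP -> [/eqP + e]; rewrite e.
suff -> : A = sel_box m by rewrite card_sel_box.
apply/eqP; rewrite eqEsubset mA andbT; apply/subsetP => -[j v] jA.
rewrite in_sel_box; apply/negPn/negP => ne.
suff: (j, v) \in facet_points A by rewrite f0 in_set0.
apply/facet_pointsP; split=> //; exists (j, m j).
  by apply: (subsetP mA); rewrite in_sel_box.
by split=> //; rewrite xpair_eqE eqxx /= eq_sym.
Qed.

(** Supplies the first and the last facet for a shelling of the boundary of a cell of positive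
    dimension. *)
Lemma facet_points_row A : valid_box A -> (d < #|A|)%N ->
  exists p q, [/\ p \in facet_points A, q \in facet_points A, p != q & p.1 = q.1].
Proof.
move=> vA cA; have [m mA _] := valid_box_sel vA.
have /set0Pn[p pF] : facet_points A != set0 by rewrite (facet_pointsE mA) gtn_eqF.
have /facet_pointsP[pA [q qA [qp e]]] := pF.
exists p, q; split=> //; last by rewrite eq_sym.
by apply/facet_pointsP; split=> //; exists p => //; rewrite eq_sym.
Qed.

(* A sorted box lies on a monotone lattice path, along which [p.1 + p.2]
   increases by one at each step. *)
Lemma sorted_box_rank_inj A : sorted_box A ->
  {in A &, injective (fun p => (p.1 + p.2)%N)}.
Proof.
move=> /sorted_boxP sA [i u] [j v] pA qA /= e.
have := sA _ _ pA qA; have := sA _ _ qA pA => /= h1 h2.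
have ij : i = j :> nat by case: (ltngtP i j) => // h; [have := h2 h|have := h1 h]; lia.
have uv : u = v :> nat by lia.
by congr pair; apply: val_inj.
Qed.

End Boxes.

(** * Acyclicity of the complex of bounded boxes *)

Section BoxLabels.
Variables (d n : nat).
Local Notation box := {set 'I_d * 'I_n}.
Implicit Types (A B Z : box) (p q : 'I_d * 'I_n) (j k : 'I_d) (v : 'I_n).

Definition box_label A : 'X_{1..n} := [multinom #|[set p in A | p.2 == v]| | v < n].

Lemma box_labelE A v : box_label A v = #|[set p in A | p.2 == v]|.
Proof. by rewrite mnmE. Qed.

Lemma box_label_sub A B : B \subset A -> (box_label B <= box_label A)%MM.
Proof.
move=> /subsetP s; apply/mnm_lepP => v; rewrite !box_labelE; apply: subset_leq_card.
by apply/subsetP => p; rewrite !inE => /andP[/s -> ->].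
Qed.

Lemma box_labelD1 A p : p \in A -> box_label A = (box_label (A :\ p) + U_(p.2))%MM.
Proof.
move=> pA; apply/mnmP => v; rewrite mnmDE !box_labelE mnm1E (cardsD1 p) inE pA /= addnC.
by congr (_ + _)%N; apply: eq_card => q; rewrite !inE andbA.
Qed.

Lemma mdeg_box_label A : mdeg (box_label A) = #|A|.
Proof.
rewrite mdegE -sum1_card (partition_big snd predT) //=; apply: eq_bigr => v _.
by rewrite box_labelE -sum1_card; apply: eq_bigl => p; rewrite inE.
Qed.

Lemma box_label_sel (m : 'I_d -> 'I_n) v :
  box_label (sel_box m) v = (\sum_j (v == m j))%N.
Proof.
rewrite box_labelE -sum1_card big_mkcond /= (eq_bigr (fun p =>
  (p.2 == v) * (p.2 == m p.1))%N).
  rewrite -(pair_bigA _ (fun j u => (u == v) * (u == m j))%N) /=; apply: eq_bigr => j _.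
  by rewrite (bigD1 v) //= eqxx mul1n big1 ?addn0 // => u /negbTE ->.
by move=> p _; rewrite !inE mulnb andbC; case: andP.
Qed.

Lemma box_label_sel_sum (m : 'I_d -> 'I_n) : box_label (sel_box m) = (\sum_j U_(m j))%MM.
Proof.
apply/mnmP => v; rewrite box_label_sel mnm_sumE; apply: eq_bigr => j _.
by rewrite mnm1E eq_sym.
Qed.

End BoxLabels.

(** * Contraction of box chains over an abstract incidence function *)

Section Acyclicity.
Variables (d n : nat) (K : comNzRingType).
Local Notation box := {set 'I_d * 'I_n}.
Implicit Types (A B Z : box) (p q : 'I_d * 'I_n) (j k : 'I_d) (v : 'I_n).

Definition toggle p A : box := if p \in A then A :\ p else p |: A.

Lemma toggleK p : involutive (toggle p).
Proof.
move=> A; rewrite /toggle; case: (boolP (p \in A)) => pA.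
  by rewrite in_setD1 eqxx /= setD1K.
by rewrite setU11 setU1K.
Qed.

(** What the contraction keeps of an incidence function, with values in the coefficient ring. The
    field [box_inc_edge] stands for the squares whose bottom is the empty face, which is not a valid
    box. *)
Record box_incidence (eps : box -> box -> K) : Prop := BoxIncidence {
  box_inc_sq : forall A p, valid_box A -> p \in A -> valid_box (A :\ p) ->
    eps A (A :\ p) * eps A (A :\ p) = 1;
  box_inc_facet : forall A B, eps A B != 0 ->
    [/\ valid_box A, valid_box B & exists2 p, p \in A & B = A :\ p];
  box_inc_diamond : forall A p q, valid_box A -> p \in A -> q \in A -> p != q ->
    valid_box (A :\ p :\ q) ->
    eps A (A :\ p) * eps (A :\ p) (A :\ p :\ q) +
    eps A (A :\ q) * eps (A :\ q) (A :\ p :\ q) = 0;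
  box_inc_edge : forall A p q, valid_box A -> #|A| = d.+1 -> p \in A -> q \in A ->
    p != q -> p.1 = q.1 -> eps A (A :\ p) + eps A (A :\ q) = 0 }.

Variable eps : box -> box -> K.
Hypothesis inc : box_incidence eps.

Definition box_bdry (z : box -> K) B : K := \sum_A z A * eps A B.

Lemma setD1_inj A p q : p \in A -> A :\ p = A :\ q -> p = q.
Proof.
by move=> pA /setP/(_ p); rewrite !in_setD1 eqxx pA andbT /=; case: eqVneq.
Qed.

(** A box strictly between [B] and [Z] deletes one of the two pairs of [Z] missing from [B], so at
    most two terms survive, and they cancel by the diamond relation. *)
Lemma box_bdry2 Z B : \sum_A eps Z A * eps A B = 0.
Proof.
have [/existsP[A0 nz] | /existsPn z0] := boolP [exists A, eps Z A * eps A B != 0];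
  last first.
  by apply: big1 => A _; apply/eqP/negPn/z0.
have nz1 : eps Z A0 != 0 by apply: contraNneq nz => ->; rewrite mul0r.
have nz2 : eps A0 B != 0 by apply: contraNneq nz => ->; rewrite mulr0.
have [vZ vA0 [p pZ eA0]] := box_inc_facet inc nz1.
have [_ vB [q qA0 eB]] := box_inc_facet inc nz2.
move: qA0; rewrite eA0 in_setD1 => /andP[qp qZ].
rewrite (bigD1 A0) //= (bigD1 (Z :\ q)) /=; last first.
  by rewrite eA0; apply: contraNneq qp => /(setD1_inj qZ) ->.
rewrite addrA big1 ?addr0; last first.
  move=> A /andP[AA0 Aq]; apply/eqP/negPn/negP => nzA.
  have nzA1 : eps Z A != 0 by apply: contraNneq nzA => ->; rewrite mul0r.
  have nzA2 : eps A B != 0 by apply: contraNneq nzA => ->; rewrite mulr0.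
  have [_ _ [p' pZ' eA]] := box_inc_facet inc nzA1.
  have [_ _ [q' _ eB']] := box_inc_facet inc nzA2.
  have : p' \notin B by rewrite eB' eA !inE eqxx andbF.
  rewrite eB eA0 !inE pZ' andbT negb_and !negbK => /orP[]/eqP e.
    by rewrite eA e eqxx in Aq.
  by rewrite eA e eA0 eqxx in AA0.
rewrite eA0 eB eA0; apply: box_inc_diamond => //; first by rewrite eq_sym.
by rewrite -eA0 -eB.
Qed.

(** The augmentation kills boundaries: an edge is a vertex box with one more pair [r], and its only
    valid facets delete [r] or the pair [s] of the vertex in the same row. *)
Lemma box_bdry_vertices Z : \sum_(A : box | #|A| == d) eps Z A = 0.
Proof.
have [vZ|nvZ] := boolP (valid_box Z); last first.
  apply: big1 => A _; apply/eqP/negPn/negP => /(box_inc_facet inc)[vZ].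
  by rewrite vZ in nvZ.
have [cZ|ncZ] := eqVneq #|Z| d.+1; last first.
  apply: big1 => A /eqP cA; apply/eqP/negPn/negP => /(box_inc_facet inc)[_ _ [p pZ eA]].
  by rewrite (cardsD1 p) pZ -eA cA add1n eqxx in ncZ.
have [m mZ _] := valid_box_sel vZ.
have : #|Z :\: sel_box m| == 1%N.
  by rewrite cardsD (setIidPr mZ) cZ card_sel_box subSn ?subnn.
move=> /cards1P[r er].
have : r \in Z :\: sel_box m by rewrite er inE.
rewrite in_setD => /andP[rm rZ].
pose s := (r.1, m r.1).
have sZ : s \in Z by apply: (subsetP mZ); rewrite in_sel_box.
have rs : r != s.
  by apply: contraNneq rm => ->; rewrite in_sel_box.
have rP p : p \in Z -> p \notin sel_box m -> p = r.
  by move=> pZ pm; apply/set1P; rewrite -er in_setD pm.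
have cD p : p \in Z -> #|Z :\ p| == d.
  by move=> pZ; move: cZ; rewrite (cardsD1 p) pZ add1n => /eq_add_S ->.
rewrite (bigD1 (Z :\ r)) ?cD //= (bigD1 (Z :\ s)) /=; last first.
  rewrite cD //=; apply: contraNneq rs => /(setD1_inj sZ) e.
  by rewrite e.
rewrite addrA big1 ?addr0; first exact: box_inc_edge.
move=> A /andP[/andP[_ Ar] As]; apply/eqP/negPn/negP.
move=> /(box_inc_facet inc)[_ vA [p pZ eA]].
move: vA; rewrite eA valid_boxD1 // => /facet_pointsP[_ [q qZ [qp qp1]]].
have pr : p != r by apply: contraNneq Ar => <-; rewrite eA.
have ps : p != s by apply: contraNneq As => <-; rewrite eA.
have pm : p \in sel_box m by apply: contraNT pr => /(rP _ pZ) ->.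
have qr : q = r.
  apply: rP => //; apply: contra qp; move: pm; rewrite !inE => /eqP pm /eqP qm.
  by rewrite [q]surjective_pairing [p]surjective_pairing qm pm qp1.
case/negP: ps; move: pm; rewrite inE => /eqP pm.
by rewrite [p]surjective_pairing pm -qp1 qr.
Qed.

Section Homotopy.
Variables (P : pred box) (g : 'I_d -> 'I_n).

Definition greedy_upto (k : nat) A : bool :=
  [forall p in A, (p.1 < k)%N ==> (p.2 == g p.1)].

Lemma greedy_uptoP (k : nat) A :
  reflect (forall p, p \in A -> (p.1 < k)%N -> p.2 = g p.1) (greedy_upto k A).
Proof.
apply: (iffP forall_inP) => h p pA; first by move=> pk; apply/eqP/(implyP (h p pA)).
by apply/implyP => pk; apply/eqP/h.
Qed.

(** [P] abstracts the subcomplex of the cells whose label divides x^b: it is closed under valid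
    sub-boxes and under the additions made by the matching. *)
Hypothesis P_valid : forall A, P A -> valid_box A.
Hypothesis P_sub : forall A B, P A -> B \subset A -> valid_box B -> P B.
Hypothesis P_greedy : forall A k, P A -> greedy_upto k A -> P ((k, g k) |: A).

(** [w] lifts each box of [z] without [r] to its partner containing [r]. The sign is the incidence
    of the pair, so that its square disappears in the boundary. *)
Lemma greedy_step (z : box -> K) k :
  (forall A, z A != 0 -> P A /\ greedy_upto k A) ->
  (forall B, valid_box B -> box_bdry z B = 0) ->
  exists2 w, (forall A, w A != 0 -> P A) &
    forall A, valid_box A -> z A - box_bdry w A != 0 -> P A /\ greedy_upto k.+1 A.
Proof.
move=> supp_z cyc_z; pose r := (k, g k).
pose w A := if r \in A then eps A (A :\ r) * z (A :\ r) else 0.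
have w_supp A : w A != 0 -> P A.
  rewrite /w; case: ifP => [rA nz|_]; last by rewrite eqxx.
  have : z (A :\ r) != 0 by apply: contraNneq nz => ->; rewrite mulr0.
  by move=> /supp_z[PA gA]; rewrite -(setD1K rA); apply: P_greedy.
exists w => // A vA nz.
(* Where [z] vanishes for this reason, a nonzero value comes from [box_bdry w]. Then [A] is a facet
   of a box in the support of [w], hence lies in [P] and has greedy first rows after all. *)
have [nPA|] := boolP (P A && greedy_upto k A); last first.
  move=> nPA; have zA0 : z A = 0.
    by apply/eqP/negPn/negP => /supp_z/andP; rewrite (negbTE nPA).
  case/negP: nPA; move: nz; rewrite zA0 sub0r oppr_eq0 => nz.
  suff [B [wB eB]] : exists B, w B != 0 /\ eps B A != 0.
    have [_ _ [p pB eA]] := box_inc_facet inc eB.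
    rewrite (P_sub (w_supp _ wB)) ?eA ?subD1set -?eA //=.
    move: wB; rewrite /w; case: ifP; rewrite ?eqxx // => rB wB.
    have : z (B :\ r) != 0 by apply: contraNneq wB => ->; rewrite mulr0.
    move=> /supp_z[_ /greedy_uptoP gB]; apply/greedy_uptoP => q.
    rewrite eA in_setD1 => /andP[_ qB] qk; apply: gB => //.
    by rewrite in_setD1 qB andbT; apply: contraTneq qk => ->; rewrite ltnn.
  have [/existsP[B nzB] | /existsPn h] := boolP [exists B, w B * eps B A != 0].
    exists B; split; apply: contraNneq nzB => ->; first by rewrite mul0r.
    by rewrite mulr0.
  by case/eqP: nz; apply: big1 => B _; apply/eqP/negPn/h.
(* Now row [k] of [A] is not the singleton [{g k}], and the two values have to agree. Reindexing by
   [toggle r] compares the boundary of [w] with [z] term by term. *)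
have /andP[PA gA] := nPA; split=> //; apply/negPn/negP => ngA.
case/eqP: nz; apply/eqP; rewrite subr_eq0; apply/eqP/esym.
rewrite /box_bdry (reindex_inj (inv_inj (toggleK r))) /=.
have [rA|rA] := boolP (r \in A); last first.
  rewrite (bigD1 A) //= big1 ?addr0; last first.
    move=> B BA; apply/eqP/negPn/negP => nzB.
    have wB : w (toggle r B) != 0 by apply: contraNneq nzB => ->; rewrite mul0r.
    have eB : eps (toggle r B) A != 0 by apply: contraNneq nzB => ->; rewrite mulr0.
    have [_ _ [p pB eA]] := box_inc_facet inc eB.
    have rB : r \in toggle r B by move: wB; rewrite /w; case: ifP; rewrite ?eqxx.
    case/eqP: BA; apply: (inv_inj (toggleK r)).
    have pr : p = r by apply/eqP/negPn/negP => pr; rewrite eA in_setD1 rB eq_sym pr in rA.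
    by rewrite {2}/toggle (negbTE rA) eA pr setD1K.
  have eT : toggle r A = r |: A by rewrite /toggle (negbTE rA).
  rewrite eT /w setU11 setU1K // mulrAC -{2 4}(setU1K rA) box_inc_sq ?mul1r ?setU11 //.
    exact/P_valid/P_greedy.
  by rewrite setU1K.
(* Row [k] has a second element, so [A :\ r] is valid; the cycle condition there expresses [z A]
   through the other boxes above [A :\ r]. *)
have vAr : valid_box (A :\ r).
  rewrite valid_boxD1 //; apply/facet_pointsP; split=> //.
  move: ngA => /forall_inPn[q qA]; rewrite negb_imply ltnS => /andP[qk ng].
  have qk1 : q.1 = k.
    apply: val_inj => /=; apply/eqP; rewrite eqn_leq qk leqNgt; apply: contra ng => h.
    by apply/eqP/(greedy_uptoP _ _ gA).
  by exists q => //; split => //; apply: contraNneq ng => ->.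
have eAr := box_inc_sq inc vA rA vAr.
transitivity (- eps A (A :\ r) * \sum_(B | B != A) z B * eps B (A :\ r)); last first.
  have := cyc_z _ vAr; rewrite /box_bdry (bigD1 A) //= => /eqP.
  rewrite addrC addr_eq0 => /eqP ->.
  by rewrite mulrN mulNr opprK mulrC -mulrA eAr mulr1.
rewrite (bigD1 A) //= {1}/w /toggle rA in_setD1 eqxx /= mul0r add0r mulr_sumr.
apply: eq_bigr => B BA.
have [zB|zB] := eqVneq (z B) 0.
  suff -> : w (if r \in B then B :\ r else r |: B) = 0 by rewrite zB !mul0r mulr0.
  rewrite /w; case: (boolP (r \in B)) => rB; first by rewrite in_setD1 eqxx.
  by rewrite setU11 setU1K // zB mulr0.
have [PB gB] := supp_z _ zB.
case: (boolP (r \in B)) => rB.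
  rewrite {1}/w in_setD1 eqxx /= mul0r; apply/esym.
  suff -> : eps B (A :\ r) = 0 by rewrite !mulr0.
  apply/eqP/negPn/negP => /(box_inc_facet inc)[_ _ [p pB e]].
  case/eqP: BA; rewrite -(setD1K rA) e; suff -> : p = r by rewrite setD1K.
  by apply/eqP/negPn/negP => pr; move/setP/(_ r): e; rewrite !inE eqxx rB eq_sym pr.
rewrite {1}/w setU11 setU1K //.
have vrB : valid_box (r |: B) by apply/P_valid/P_greedy.
have vB := P_valid PB.
have sqB := @box_inc_sq _ inc (r |: B) r vrB (setU11 _ _).
rewrite setU1K // in sqB.
have [e0|] := eqVneq (eps B (A :\ r)) 0.
  rewrite e0 !mulr0; suff -> : eps (r |: B) A = 0 by rewrite mulr0.
  apply/eqP/negPn/negP => /(box_inc_facet inc)[_ _ [p pB eA]].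
  have pr : r != p by move: rA; rewrite eA !inE => /andP[].
  have e : A :\ r = B :\ p.
    by rewrite eA; apply/setP => x; rewrite !inE; case: eqVneq => [->|];
      rewrite ?(negbTE rB) ?andbF.
  move: pB; rewrite in_setU1 eq_sym (negbTE pr) /= => pB.
  have := box_inc_sq inc vB pB; rewrite -e e0 mul0r => /(_ vAr)/eqP.
  by rewrite eq_sym oner_eq0.
move=> /(box_inc_facet inc)[_ _ [p pB eA]].
have pr : p != r by apply: contraNneq rB => <-.
have eA' : A = (r |: B) :\ p.
  by rewrite -(setD1K rA) eA; apply/setP => x; rewrite !inE; case: eqVneq => [->|] //=;
    rewrite eq_sym pr.
(* The square [r |: B], [B], [A], [A :\ r] anticommutes; since the incidences squared are 1, this
   can be solved for the product in [h1]. *)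
have := @box_inc_diamond _ inc (r |: B) r p vrB (setU11 _ _).
rewrite in_setU1 pB orbT setU1K // -eA -eA' eq_sym pr => /(_ isT isT vAr) /eqP.
rewrite addrC addr_eq0 => /eqP dia.
have h1 : eps (r |: B) B * eps (r |: B) A = - eps B (A :\ r) * eps A (A :\ r).
  rewrite -[LHS]mulr1 -eAr -[RHS]mulr1 -(sqB vB) mulrACA [X in _ * X]dia; ring.
by rewrite mulrAC h1; ring.
Qed.

Lemma box_bdryD w1 w2 A :
  box_bdry (fun B => w1 B + w2 B) A = box_bdry w1 A + box_bdry w2 A.
Proof. by rewrite -big_split; apply: eq_bigr => B _; rewrite mulrDl. Qed.

Lemma box_bdryB w1 w2 A :
  box_bdry (fun B => w1 B - w2 B) A = box_bdry w1 A - box_bdry w2 A.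
Proof. by rewrite -sumrB; apply: eq_bigr => B _; rewrite mulrBl. Qed.

Lemma box_bdry_bdry w A : box_bdry (box_bdry w) A = 0.
Proof.
rewrite /box_bdry; under eq_bigr do rewrite mulr_suml.
rewrite exchange_big big1 // => Z _; under eq_bigr do rewrite -mulrA.
by rewrite -mulr_sumr box_bdry2 mulr0.
Qed.

Lemma box_bdry_sum_vertices w : \sum_(A : box | #|A| == d) box_bdry w A = 0.
Proof.
rewrite exchange_big big1 // => Z _.
by rewrite -mulr_sumr box_bdry_vertices mulr0.
Qed.

Lemma box_bdry_invalid w A : ~~ valid_box A -> box_bdry w A = 0.
Proof.
move=> nvA; apply: big1 => B _; suff -> : eps B A = 0 by rewrite mulr0.
by apply/eqP/negPn/negP => /(box_inc_facet inc)[_ vA]; rewrite vA in nvA.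
Qed.

Lemma greedy_reduce (z : box -> K) (k : nat) : (k <= d)%N ->
  (forall A, z A != 0 -> P A) ->
  (forall B, valid_box B -> box_bdry z B = 0) ->
  exists2 w, (forall A, w A != 0 -> P A) &
    forall A, z A - box_bdry w A != 0 -> P A /\ greedy_upto k A.
Proof.
move=> + Pz cz; elim: k => [_|k IH kd].
  exists (fun=> 0) => [A|A]; first by rewrite eqxx.
  rewrite /box_bdry big1 ?subr0 => [/Pz PA|B _]; last by rewrite mul0r.
  by split=> //; apply/greedy_uptoP.
have [w Pw hw] := IH (ltnW kd).
have [B vB|w' Pw' hw'] := @greedy_step (fun A => z A - box_bdry w A) (Ordinal kd) hw.
  by rewrite box_bdryB cz // box_bdry_bdry subr0.
exists (fun A => w A + w' A) => [A|A].
  have [->|/Pw//] := eqVneq (w A) 0.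
  by rewrite add0r => /Pw'.
rewrite box_bdryD opprD addrA => nz; apply: hw' => //.
apply: contraNT nz => nvA; rewrite !box_bdry_invalid // !subr0.
by apply/negPn/negP => /Pz/P_valid; rewrite (negbTE nvA).
Qed.

(** After all [d] rows only the vertex [sel_box g] can remain, and its coefficient is the
    augmentation of the remainder, which is 0. *)
Lemma greedy_acyclic (z : box -> K) :
  (forall A, z A != 0 -> P A) ->
  (forall B, valid_box B -> box_bdry z B = 0) ->
  \sum_(A : box | #|A| == d) z A = 0 ->
  exists2 w, (forall A, w A != 0 -> P A) & forall A, z A = box_bdry w A.
Proof.
move=> Pz cz z0; have [w Pw hw] := greedy_reduce (leqnn d) Pz cz.
exists w => // A; apply/eqP; rewrite -subr_eq0; apply/negPn/negP => nz.
have only B : z B - box_bdry w B != 0 -> B = sel_box g.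
  move=> /hw[/P_valid/andP[_ /full_boxP fB] /greedy_uptoP gB].
  have sB : B \subset sel_box g by apply/subsetP => p pB; rewrite inE gB.
  apply/eqP; rewrite eqEsubset sB /=; apply/subsetP => -[j v].
  rewrite in_sel_box => /eqP ->; have [u uB] := fB j.
  by rewrite -(gB _ uB).
have : \sum_(B : box | #|B| == d) (z B - box_bdry w B) = 0.
  by rewrite sumrB z0 box_bdry_sum_vertices subr0.
rewrite (bigD1 (sel_box g)) ?card_sel_box //= big1 ?addr0 => [|B /andP[_ nB]].
  by rewrite -(only _ nz) => /eqP; rewrite (negbTE nz).
by apply/eqP/negPn/negP => /only/eqP; rewrite (negbTE nB).
Qed.

End Homotopy.

End Acyclicity.

Lemma card_ord_lt (d k : nat) : (k <= d)%N -> #|[set i : 'I_d | (i < k)%N]| = k.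
Proof.
move=> kd; rewrite -sum1_card (eq_bigl (fun i : 'I_d => (i < k)%N)) => [|i].
  by rewrite (big_ord_narrow kd) sum1_card card_ord.
by rewrite inE.
Qed.

(** * The leftmost vertex in a given multidegree *)

Section Greedy.
Variables (d n : nat) (b : 'X_{1..n}).
Local Notation box := {set 'I_d * 'I_n}.
Implicit Types (A B : box) (p q : 'I_d * 'I_n) (j k : 'I_d) (v : 'I_n).

Definition mass_below (u : nat) : nat := (\sum_(v < n | v < u) b v)%N.

Lemma mass_belowS v : mass_below v.+1 = (mass_below v + b v)%N.
Proof.
rewrite /mass_below (bigD1 v) //= addnC; congr (_ + _)%N.
by apply: eq_bigl => u; rewrite ltnS ltn_neqAle andbC.
Qed.

Lemma leq_mass_below (u v : nat) : (u <= v)%N -> (mass_below u <= mass_below v)%N.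
Proof.
move=> uv; rewrite /mass_below [leqRHS](bigID (fun i : 'I_n => (i < u)%N)) /=.
rewrite [X in (_ <= X + _)%N](eq_bigl (fun i : 'I_n => (i < u)%N)) ?leq_addr // => i.
by case: (ltnP i u) => [iu|]; rewrite ?andbF ?(leq_trans iu uv).
Qed.

(** Write x^b as a nondecreasing word: the letters [v] start at position [mass_below v], and [g j]
    is the letter at position [j]. *)
Lemma greedy_vertex_exists : (d <= mdeg b)%N ->
  exists g : 'I_d -> 'I_n, forall j, (mass_below (g j) <= j < mass_below (g j).+1)%N.
Proof.
move=> db; apply: (@fin_all_exists _ _ (fun j (v : 'I_n) =>
  (mass_below v <= j < mass_below v.+1)%N)) => j.
have mn : mass_below n = mdeg b.
  by rewrite mdegE /mass_below; apply: eq_bigl => i; rewrite ltn_ord.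
have ex : exists u : nat, (j < mass_below u)%N.
  by exists n; rewrite mn (leq_trans (ltn_ord j)).
case: (ex_minnP ex) => -[|u]; first by rewrite /mass_below big1.
move=> ju min_u; have un : (u < n)%N.
  by rewrite min_u // mn (leq_trans (ltn_ord j)).
exists (Ordinal un); rewrite /= ju andbT leqNgt; apply/negP => /min_u.
by rewrite ltnn.
Qed.

Definition bounded_box A : bool := valid_box A && (box_label A <= b)%MM.

(** A selection through [(j, v)] puts the [j.+1] rows up to [j] into columns at most [v], where the
    label bound leaves room for only [mass_below v.+1] elements. *)
Lemma bounded_box_mass A (j : 'I_d) v :
  bounded_box A -> (j, v) \in A -> (j < mass_below v.+1)%N.
Proof.
move=> /andP[/andP[/sorted_boxP sA fA] lA] jA.
have [m [mA mj]] := full_box_sel_through fA jA.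
have jd : (j.+1 <= d)%N by exact: ltn_ord.
rewrite -[X in (X <= _)%N](card_ord_lt jd).
have inj : injective (fun i : 'I_d => (i, m i)) by move=> i i' [].
rewrite -(card_imset _ inj).
apply: (@leq_trans #|[set p in A | (p.2 < v.+1)%N]|).
  apply/subset_leq_card/subsetP => p /imsetP[i]; rewrite inE ltnS => ij ->.
  have iA : (i, m i) \in A by apply: (subsetP mA); rewrite in_sel_box.
  rewrite inE iA /= ltnS; move: ij; rewrite leq_eqVlt => /orP[/eqP ij|ij].
    by have -> : i = j by [exact: val_inj]; rewrite (mj : m j = v).
  by have := sA _ _ iA jA ij.
rewrite -sum1_card (partition_big snd (fun u : 'I_n => (u < v.+1)%N)) /=; last first.
  by move=> p; rewrite inE => /andP[].
apply: leq_sum => u uv; have /mnm_lepP/(_ u) := lA; apply: leq_trans.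
rewrite box_labelE -sum1_card; apply/eq_leq/eq_bigl => p; rewrite !inE.
by case: eqP => [->|]; rewrite ?uv ?andbF ?andbT.
Qed.

Section GreedyBox.
Variable g : 'I_d -> 'I_n.
Hypothesis gP : forall j, (mass_below (g j) <= j < mass_below (g j).+1)%N.

Lemma bounded_box_ge_greedy A (j : 'I_d) v : bounded_box A -> (j, v) \in A -> (g j <= v)%N.
Proof.
move=> bA jA; rewrite leqNgt; apply/negP => /leq_mass_below.
by have := bounded_box_mass bA jA; case/andP: (gP j); lia.
Qed.

(** If [(k, g k)] is new, row [k] contains some [u] larger than [g k], so later rows lie strictly to
    the right of column [g k]; earlier rows consist of letters [g i] at most [g k]. *)
Lemma bounded_box_greedy A k : bounded_box A -> greedy_upto g k A ->
  bounded_box ((k, g k) |: A).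
Proof.
move=> bA gA; have [kA|kA] := boolP ((k, g k) \in A).
  by rewrite (setUidPr _) // sub1set.
have /andP[vA /mnm_lepP lA] := bA.
have /andP[/sorted_boxP sA /full_boxP fA] := vA.
have [u uA] := fA k; have gu := bounded_box_ge_greedy bA uA.
have ku : (g k < u)%N.
  by rewrite ltn_neqAle gu andbT; apply: contraNneq kA => /val_inj ->.
have below p : p \in A -> (p.1 < k)%N -> (p.2 <= g k)%N.
  move=> pA pk; rewrite ((greedy_uptoP _ _ _ gA) _ pA pk) leqNgt; apply/negP => h.
  have := leq_mass_below h; have /andP[g1 _] := gP p.1; have /andP[_ g2] := gP k.
  by move: pk; move: g1 g2; lia.
have above p : p \in A -> (k < p.1)%N -> (g k < p.2)%N.
  by move=> pA kp; apply: leq_trans ku _; apply: (sA _ _ uA pA).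
have vA' : valid_box ((k, g k) |: A).
  apply/andP; split; last first.
    by apply/full_boxP => j; have [v vA'] := fA j; exists v; rewrite in_setU1 vA' orbT.
  apply/sorted_boxP => p q; rewrite !in_setU1.
  move=> /orP[/eqP ->|pA] /orP[/eqP ->|qA] /=; rewrite ?ltnn //.
  - by move=> /(above _ qA)/ltnW.
  - exact: below.
  - exact: sA.
rewrite /bounded_box vA' /=; apply/mnm_lepP => v.
rewrite (@box_labelD1 _ _ _ (k, g k)) ?setU11 // setU1K // mnmDE mnm1E /=.
case: eqVneq => [<-|_]; last by rewrite addn0.
rewrite addn1 box_labelE.
have inj : {in [set p in A | p.2 == g k] &, injective (fun p => p.1 : 'I_d)}.
  move=> [i1 w1] [i2 w2]; rewrite !inE /= => /andP[_ /eqP ->] /andP[_ /eqP ->] -> //.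
rewrite -(card_in_imset inj).
(* Column [g k] of [A] is met only by rows [i] before [k] with [g i = g k], which start at
   [mass_below (g k)]; one more element still fits under [b (g k)]. *)
apply: (@leq_ltn_trans #|[set i : 'I_d | (i < k)%N] :\: [set i : 'I_d | (i < mass_below (g k))%N]|).
  apply/subset_leq_card/subsetP => i /imsetP[p]; rewrite inE => /andP[pA /eqP pk] ->.
  rewrite !inE -leqNgt; case: (ltngtP p.1 k) => [pk1|kp|/val_inj e].
  - have e := (greedy_uptoP _ _ _ gA) _ pA pk1; rewrite pk in e.
    by rewrite andbT; rewrite e; case/andP: (gP p.1).
  - by have := above _ pA kp; rewrite pk ltnn.
  - by case/negP: kA; suff <- : p = (k, g k); rewrite // [LHS]surjective_pairing pk e.
have /andP[g1 g2] := gP k; move: g2; rewrite mass_belowS.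
rewrite cardsD (setIidPr _); last first.
  by apply/subsetP => i; rewrite !inE => /leq_trans; apply.
have kd := ltn_ord k; rewrite !card_ord_lt; lia.
Qed.

End GreedyBox.

Lemma bounded_box_sub A B :
  bounded_box A -> B \subset A -> valid_box B -> bounded_box B.
Proof.
move=> /andP[_ lA] BA vB; rewrite /bounded_box vB.
exact: lepm_trans (box_label_sub BA) lA.
Qed.

(** In degree exactly [d] the greedy word exhausts x^b. This yields both the vertex with a given
    label and the factorisation of a monomial into [d] variables. *)
Lemma vertex_box_exists : mdeg b = d ->
  exists g : 'I_d -> 'I_n, valid_box (sel_box g) /\ box_label (sel_box g) = b.
Proof.
move=> db; have [|g gP] := greedy_vertex_exists; first by rewrite db.
exists g; split.
  rewrite /valid_box full_sel_box andbT; apply/sorted_boxP => p q.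
  rewrite !inE => /eqP -> /eqP -> pq; rewrite leqNgt; apply/negP => /leq_mass_below h.
  have /andP[h1 _] := gP p.1; have /andP[_ h2] := gP q.1.
  by have := ltn_trans pq (leq_trans h2 (leq_trans h h1)); rewrite ltnn.
apply/mnmP => v; rewrite box_labelE.
have massd : (mass_below v.+1 <= d)%N.
  by rewrite -db mdegE /mass_below [leqRHS](bigID (fun u : 'I_n =>
    (u < v.+1)%N)) leq_addr.
have inj : injective (fun j => (j, g j)) by move=> i i' [].
transitivity #|[set i : 'I_d | (i < mass_below v.+1)%N] :\: [set i : 'I_d | (i < mass_below v)%N]|.
  rewrite -(card_imset _ inj); apply: eq_card => -[j u]; rewrite !inE /=.
  apply/idP/imsetP => [/andP[/eqP -> /eqP e]|[i]].
    by exists j => //; rewrite !inE -leqNgt -e.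
  rewrite !inE -leqNgt => /andP[i1 i2] [-> ->]; rewrite eqxx /=.
  have /andP[g1 g2] := gP i; apply/eqP/val_inj => /=.
  by case: (ltngtP (g i) v) => // /leq_mass_below h; lia.
rewrite cardsD (setIidPr _); last first.
  apply/subsetP => i; rewrite !inE => /leq_trans; apply.
  exact: (leq_mass_below (leqnSn v)).
have e := mass_belowS v; rewrite !card_ord_lt; lia.
Qed.

Lemma bounded_box_acyclic (K : comNzRingType) (eps : box -> box -> K) (z : box -> K) :
  box_incidence eps ->
  (forall A, z A != 0 -> bounded_box A) ->
  (forall B, valid_box B -> box_bdry eps z B = 0) ->
  \sum_(A : box | #|A| == d) z A = 0 ->
  exists2 w, (forall A, w A != 0 -> bounded_box A) &
    forall A, z A = box_bdry eps w A.
Proof.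
move=> inc bz cz z0.
have [db|db] := leqP d (mdeg b); last first.
  have nb A : ~~ bounded_box A.
    apply/negP => /andP[/card_valid_box cA /mnm_lepP lA].
    have : (#|A| <= mdeg b)%N.
      by rewrite -mdeg_box_label !mdegE; apply: leq_sum => i _; apply: lA.
    by move: cA db; lia.
  exists (fun=> 0) => A; first by rewrite eqxx.
  rewrite /box_bdry big1 => [|B _]; last by rewrite mul0r.
  by apply/eqP/negPn/negP => /bz; apply/negP.
have [g gP] := greedy_vertex_exists db.
apply: (greedy_acyclic inc _ bounded_box_sub (bounded_box_greedy gP) bz cz z0).
by move=> A /andP[].
Qed.

End Greedy.

(** * Explicit signs for one incidence function *)

Section BoxSigns.
Variables (d n : nat).
Local Notation box := {set 'I_d * 'I_n}.
Implicit Types (A B : box) (p q : 'I_d * 'I_n).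

Definition lex_key p : nat := (p.1 * n + p.2)%N.

Lemma lex_key_inj : injective lex_key.
Proof.
move=> [i u] [j v] /= e; have un := ltn_ord u; have vn := ltn_ord v.
have ij : i = j :> nat.
  have := congr1 (fun k => k %/ n)%N e.
  by rewrite /lex_key !divnMDl ?(leq_ltn_trans _ un) // !divn_small // !addn0.
have uv : u = v :> nat by move: e; rewrite /lex_key /= ij => /addnI.
by congr pair; apply: val_inj.
Qed.

Definition before A p : nat := #|[set q in A | (lex_key q < lex_key p)%N]|.

(* The cellular sign of a product of simplices: [p] has [before A p] predecessors in
   [A], of which one in each of the [p.1] earlier rows carries no dimension. *)
Definition box_sign A p : int := (-1) ^+ (before A p + p.1).

Lemma before_D1 A p q : q \in A ->
  before A p = ((lex_key q < lex_key p)%N + before (A :\ q) p)%N.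
Proof.
move=> qA; rewrite /before (cardsD1 q) inE qA; congr (_ + _)%N.
by apply: eq_card => r; rewrite !inE andbA.
Qed.

(** As for simplices: exactly one of the two deletions shifts the position of the other pair, while
    the row exponents are the same in both products. *)
Lemma box_sign_diamond A p q : p \in A -> q \in A -> p != q ->
  box_sign A p * box_sign (A :\ p) q + box_sign A q * box_sign (A :\ q) p = 0.
Proof.
move=> pA qA pq; rewrite /box_sign (before_D1 p qA) (before_D1 q pA).
have : lex_key p != lex_key q by apply: contraNneq pq => /lex_key_inj ->.
by case: ltngtP => //= _ _; rewrite !exprD ?expr0 ?expr1; ring.
Qed.

Lemma box_sign_sqr A p : box_sign A p = 1 \/ box_sign A p = -1.
Proof. by rewrite /box_sign -signr_odd; case: odd; [right|left]. Qed.

(** [A :\ q] has one pair per row, so [p] has exactly [p.1] predecessors, and [q] has one more,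
    namely [p]. *)
Lemma box_sign_edge A p q : sorted_box A -> full_box A -> #|A| = d.+1 ->
  p \in A -> q \in A -> p.1 = q.1 -> (p.2 < q.2)%N ->
  box_sign A p = 1 /\ box_sign A q = -1.
Proof.
move=> sA fA cA pA qA e lt.
have Aq : valid_box (A :\ q).
  rewrite valid_boxD1 ?/valid_box ?sA //; apply/facet_pointsP; split=> //.
  by exists p => //; split => //; apply: contraTneq lt => ->; rewrite ltnn.
have [m mA _] := valid_box_sel Aq.
have cAq : #|A :\ q| = d by move: cA; rewrite (cardsD1 q) qA => -[].
have eA := card_full_box_sel mA cAq.
have keyE (r s : 'I_d * 'I_n) : (lex_key r < lex_key s)%N =
  ((r.1 < s.1) || (r.1 == s.1) && (r.2 < s.2))%N.
  have rn := ltn_ord r.2; have sn := ltn_ord s.2; rewrite /lex_key -(inj_eq val_inj) /=.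
  by case: (ltngtP r.1 s.1) => /= h; [nia|nia|rewrite h ltn_add2l].
have before_row r : before (A :\ q) r = (r.1 + (m r.1 < r.2))%N.
  have bound : (r.1 + (m r.1 < r.2) <= d)%N by have := ltn_ord r.1; case: ltnP => /=; lia.
  rewrite -[RHS](card_ord_lt bound) /before eA.
  have inj : injective (fun j => (j, m j)) by move=> i i' [].
  rewrite -(card_imset _ inj); apply: eq_card => -[j u]; rewrite !inE keyE /=.
  apply/andP/imsetP => [[/eqP -> h]|[i]].
    exists j => //; rewrite inE; case/orP: h => [|/andP[/eqP -> ->]];
      last by rewrite addn1.
    by lia.
  rewrite inE => h [-> ->]; split=> //; move: h; case: (ltngtP i r.1) =>
    //= [ir|/val_inj ->].
    by case: ltnP => /=; lia.
  by rewrite eqxx; case: (ltnP (m r.1) r.2) => //= _; lia.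
have mp : m p.1 = p.2.
  have : p \in A :\ q by rewrite !inE pA andbT; apply: contraTneq lt => ->; rewrite ltnn.
  by rewrite eA inE => /eqP.
rewrite /box_sign !(before_D1 _ qA) !before_row !keyE -e mp !ltnn lt eqxx /= [(q.2 < p.2)%N]ltnNge (ltnW lt) /=.
have sq : (-1) ^+ (p.1 + p.1) = 1 :> int by rewrite addnn -signr_odd odd_double.
by rewrite !add0n addn0 addn1 addSn exprS sq mulr1.
Qed.

End BoxSigns.

Lemma mulmX_inj (n : nat) (K : comNzRingType) (m : 'X_{1..n}) (f g : {mpoly K[n]}) :
  f * 'X_[m] = g * 'X_[m] -> f = g.
Proof.
by move=> e; apply/mpolyP => k; have := congr1 (mcoeff (m + k)) e; rewrite !mcoeffMX.
Qed.

Lemma mcoeffMX_le (n : nat) (K : comNzRingType) (f : {mpoly K[n]}) (m b : 'X_{1..n}) :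
  (f * 'X_[m])@_b != 0 -> (m <= b)%MM.
Proof.
rewrite mcoeff_eq0 negbK (perm_mem (msuppMX _ _)) => /mapP[k _ ->].
exact: lem_addr.
Qed.

(** * From scalar chains to polynomial chains *)

Section PolyAcyclicity.
Variables (d n : nat) (K : comNzRingType).
Local Notation box := {set 'I_d * 'I_n}.
Local Notation S := {mpoly K[n]}.
Implicit Types (A B : box).
Variable eps : box -> box -> K.
Hypothesis inc : box_incidence eps.

Definition twist A B : S := (eps A B)%:MP * 'X_[box_label A - box_label B].

(** Multiplying each coefficient by the monomial of its cell untwists the cellular differential into
    the scalar one; identities are checked after this injective multiplication. *)
Lemma twist_label A B : twist A B * 'X_[box_label B] = (eps A B)%:MP * 'X_[box_label A].
Proof.
have [e0|/(box_inc_facet inc)[_ _ [p _ ->]]] := eqVneq (eps A B) 0.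
  by rewrite /twist e0 mpolyC0 !mul0r.
by rewrite /twist -mulrA -mpolyXD submK // box_label_sub // subD1set.
Qed.

Lemma twist_bdry2 Z B : \sum_A twist Z A * twist A B = 0.
Proof.
apply: (mulmX_inj (m := box_label B)); rewrite mul0r mulr_suml.
under eq_bigr => A _ do
  rewrite -mulrA twist_label mulrCA twist_label mulrA -mpolyCM [eps A B * _]mulrC.
by rewrite -mulr_suml -rmorph_sum (box_bdry2 inc) rmorph0 mul0r.
Qed.

Lemma twist_vertices Z :
  \sum_(A : box | #|A| == d) twist Z A * 'X_[box_label A] = 0.
Proof.
under eq_bigr => A _ do rewrite twist_label.
by rewrite -mulr_suml -rmorph_sum (box_bdry_vertices inc) rmorph0 mul0r.
Qed.

(** The coefficient of x^b in the untwisted chain is a scalar cycle on the boxes bounded by [b]. The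
    scalar solutions are reassembled, the division by the label being exact on their supports. *)
Lemma twist_acyclic (f : box -> S) :
  (forall A, f A != 0 -> valid_box A) ->
  (forall B, valid_box B -> \sum_A f A * twist A B = 0) ->
  \sum_(A : box | #|A| == d) f A * 'X_[box_label A] = 0 ->
  exists w, forall A, f A = \sum_B w B * twist B A.
Proof.
move=> f_valid f_cycle f_aug; pose F A := f A * 'X_[box_label A].
pose z b A : K := (F A)@_b.
(* A common degree bound leaves finitely many multidegrees to solve. *)
pose D := \max_A msize (F A).
have [w hw] : exists w : 'X_{1..n < D} -> box -> K, forall b,
    (forall A, w b A != 0 -> bounded_box b A) /\
    forall A, z b A = box_bdry eps (w b) A.
  apply: (@fin_all_exists _ _ (fun (b : 'X_{1..n < D}) (w : box -> K) =>
    (forall A, w A != 0 -> bounded_box b A) /\ forall A, z b A = box_bdry eps w A)).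
  move=> b.
  have [A|B vB||w bw hw] := @bounded_box_acyclic d n b K eps (z b) inc; last by exists w.
  - move=> nz; apply/andP; split; last exact: mcoeffMX_le nz.
    by apply: f_valid; apply: contraNneq nz => e; rewrite /z /F e mul0r mcoeff0.
  - have := congr1 (fun h => (h * 'X_[box_label B])@_b) (f_cycle B vB).
    rewrite mul0r mcoeff0 mulr_suml raddf_sum /= => h; rewrite -[RHS]h.
    by apply: eq_bigr => A _; rewrite -mulrA twist_label mulrCA mcoeffCM mulrC.
  - by have := congr1 (mcoeff b) f_aug; rewrite mcoeff0 raddf_sum.
exists (fun A => \sum_(b : 'X_{1..n < D}) w b A *: 'X_[b - box_label A]) => A.
apply: (mulmX_inj (m := box_label A)); rewrite mulr_suml.
have wX b B : w b B *: 'X_[b - box_label B] * 'X_[box_label B] = w b B *: 'X_[b].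
  have [->|/(proj1 (hw b))/andP[_ lB]] := eqVneq (w b B) 0;
    first by rewrite !scale0r mul0r.
  by rewrite -scalerAl -mpolyXD submK.
under eq_bigr => B _.
  rewrite -mulrA twist_label mulrCA mulr_suml.
  under eq_bigr => b _ do rewrite wX.
  rewrite mulr_sumr.
  over.
rewrite exchange_big /= -/(F A) [LHS](mpolywE (k := D)); last first.
  exact: (leq_bigmax (F := fun A => msize (F A)) A).
apply: eq_bigr => b _; rewrite -[(F A)@_b]/(z b A) (proj2 (hw b)) scaler_suml.
by apply: eq_bigr => B _; rewrite mul_mpolyC scalerA mulrC.
Qed.

End PolyAcyclicity.

From mathcomp Require Import boolp classical_sets functions reals.
Require Import Defs.

Import Order.TTheory GRing.Theory Num.Theory.

Local Open Scope classical_set_scope.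

(** * The polytope of a box *)

Section Clamp.
Variable R : realType.
Implicit Types t s : R.

Definition clamp t : R := Num.min (Num.max t 0) 1.

Lemma clamp_le0 t : t <= 0 -> clamp t = 0.
Proof. by move=> t0; rewrite /clamp (max_idPr t0) (min_idPl ler01). Qed.

Lemma clamp_ge1 t : 1 <= t -> clamp t = 1.
Proof. by move=> t1; rewrite /clamp; apply/min_idPr; rewrite le_max t1. Qed.

Lemma clamp_id t : 0 <= t -> t <= 1 -> clamp t = t.
Proof. by move=> t0 t1; rewrite /clamp (max_idPl t0) (min_idPl t1). Qed.

Lemma le_clamp t s : t <= s -> clamp t <= clamp s.
Proof. by move=> ts; rewrite /clamp le_min !ge_min ge_max !le_max ts !lexx !orbT. Qed.

(** The summands are the lengths that the interval [0, t] leaves in the unit intervals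
    [j, j + 1]. *)
Lemma sum_clamp (d : nat) t : 0 <= t -> \sum_(j < d) clamp (t - j%:R) = Num.min t d%:R.
Proof.
move=> t0; elim: d => [|d IH]; first by rewrite big_ord0 (min_idPr t0).
rewrite big_ord_recr /= IH -natr1.
have [td|dt] := leP t d%:R.
  by rewrite clamp_le0 ?subr_le0 // addr0 (min_idPl _) // (le_trans td) // lerDl.
have [td|td] := leP t (d%:R + 1); first by rewrite clamp_id; lra.
by rewrite clamp_ge1; lra.
Qed.
End Clamp.

Section Cells.
Variables (R : realType) (d n : nat).
Local Notation box := {set 'I_d * 'I_n}.
Local Notation V := 'rV[R]_n.
Implicit Types (A B Z : box) (p q : 'I_d * 'I_n) (j : 'I_d) (v : 'I_n).
Implicit Types (x : V) (y : 'M[R]_(d, n)).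

Definition box_coords A y : Prop :=
  [/\ forall j v, 0 <= y j v, forall j v, (j, v) \notin A -> y j v = 0 &
      forall j, \sum_v y j v = 1].

Definition colsum y : V := \row_v \sum_j y j v.

Definition box_cell A : set V := [set x | exists2 y, box_coords A y & x = colsum y].

Definition psum x (k : nat) : R := \sum_(u < n | (u < k)%N) x 0 u.

Lemma psumS x v : psum x v.+1 = psum x v + x 0 v.
Proof.
rewrite /psum (bigD1 v) //= addrC; congr (_ + _).
by apply: eq_bigl => u; rewrite ltnS ltn_neqAle andbC.
Qed.

Lemma le_psum x k l : (forall v, 0 <= x 0 v) -> (k <= l)%N -> psum x k <= psum x l.
Proof.
move=> x0 kl; rewrite /psum [leRHS](bigID (fun i : 'I_n => (i < k)%N)) /=.
rewrite [X in _ <= X + _](eq_bigl (fun i : 'I_n => (i < k)%N)) ?lerDl ?sumr_ge0 // => i.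
by case: (ltnP i k) => [ik|]; rewrite ?andbF ?(leq_trans ik kl).
Qed.

Lemma psum0 x : psum x 0 = 0.
Proof. by rewrite /psum big1. Qed.

Lemma psum_full x : psum x n = \sum_v x 0 v.
Proof. by apply: eq_bigl => u; rewrite ltn_ord. Qed.

(* Reading the points of row [j] of a sorted box as the mass that falls into
   the interval [j, j + 1] makes the decomposition of a point canonical. *)
Lemma box_coords_psum A y : sorted_box A -> box_coords A y ->
  forall j (k : nat), \sum_(u < n | (u < k)%N) y j u = clamp (psum (colsum y) k - j%:R).
Proof.
move=> /sorted_boxP sA [y0 yA y1] j k.
pose T i := \sum_(u < n | (u < k)%N) y i u.
have T0 i : 0 <= T i by apply: sumr_ge0.
have T1 i : T i <= 1.
  by rewrite -(y1 i) [leRHS](bigID (fun u : 'I_n => (u < k)%N)) lerDl sumr_ge0.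
(* If a later row has mass in the first [k] columns, sortedness forces all of an earlier row into
   them. So [T] reads 1, ..., 1, t, 0, ..., 0 and its sum determines each entry. *)
have T01 (i i' : 'I_d) : (i < i')%N -> T i' != 0 -> T i = 1.
  move=> ii' nz; have [u uk yu] : exists2 u : 'I_n, (u < k)%N & y i' u != 0.
    have [/existsP[u /andP[uk yu]] | /existsPn h] :=
      boolP [exists u : 'I_n, (u < k)%N && (y i' u != 0)]; first by exists u.
    case/eqP: nz; apply: big1 => u uk; apply/eqP.
    by have := h u; rewrite uk negbK.
  rewrite -(y1 i) [RHS](bigID (fun u : 'I_n => (u < k)%N)) /= [X in _ =
    _ + X]big1 ?addr0 // => w.
  rewrite -leqNgt => kw; apply: (yA); apply/negP => iwA.
  have iuA : (i', u) \in A by apply: contraNT yu => /yA ->.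
  by have := sA _ _ iwA iuA ii' => /= wu; have := leq_trans (leq_trans uk kw) wu;
    rewrite ltnn.
have -> : psum (colsum y) k = \sum_i T i.
  by rewrite exchange_big; apply: eq_bigr => u _; rewrite mxE.
rewrite -/(T j) (bigD1 j) //= (bigID (fun i : 'I_d => (i < j)%N)) /=.
set a := \sum_(i | _) _; set e := \sum_(i | _) _.
have cj : \sum_(i : 'I_d | (i != j) && (i < j)%N) (1 : R) = j%:R.
  rewrite -[in RHS](card_ord_lt (ltnW (ltn_ord j))) sumr_const; congr (_ *+ _).
  by apply: eq_card => i; rewrite !inE unfold_in; case: eqP => [->|_] /=; rewrite ?ltnn.
have aj : a <= j%:R by rewrite -cj; apply: ler_sum.
have e0 : 0 <= e by apply: sumr_ge0.
have [Tj0|Tj0] := eqVneq (T j) 0.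
  rewrite [e]big1 ?addr0 => [|i /andP[ij]]; first by rewrite clamp_le0 // Tj0; lra.
  rewrite -leqNgt leq_eqVlt => /orP[/eqP/val_inj ji|ji]; first by rewrite ji eqxx in ij.
  apply/eqP/negPn/negP => /(T01 _ _ ji) /eqP; rewrite Tj0 eq_sym oner_eq0 //.
have -> : a = j%:R by rewrite -cj; apply: eq_bigr => i /andP[_ ij]; apply: T01 ij Tj0.
have [Tj1|Tj1] := eqVneq (T j) 1; first by rewrite clamp_ge1 // Tj1; lra.
rewrite [e]big1 ?addr0 => [|i /andP[ij]].
  by rewrite addrK clamp_id.
rewrite -leqNgt leq_eqVlt => /orP[/eqP/val_inj ji|ji]; first by rewrite ji eqxx in ij.
by apply/eqP/negPn/negP => /(T01 _ _ ji) /eqP; rewrite (negbTE Tj1).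
Qed.

(** For nonnegative [x], column [v] occupies the interval from [psum x v] to [psum x v.+1]; the
    entry is the length of its part in [j, j + 1]. *)
Definition canon_coords x : 'M[R]_(d, n) :=
  \matrix_(j, v) (clamp (psum x v.+1 - j%:R) - clamp (psum x v - j%:R)).

Lemma box_coords_canon A y : sorted_box A -> box_coords A y -> y =
  canon_coords (colsum y).
Proof.
move=> sA yA; apply/matrixP => j v; rewrite mxE -!(box_coords_psum sA yA).
rewrite (bigD1 v) //= [X in _ + X - _](eq_bigl (fun u : 'I_n =>
  (u < v)%N)) ?addrK // => u.
by rewrite ltnS ltn_neqAle andbC.
Qed.

(** Canonical coordinates depend on the point alone, so uniqueness holds across different cells;
    this is why cells intersect as their boxes do. *)
Lemma sorted_coords_inj A B y y' : sorted_box A -> sorted_box B ->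
  box_coords A y -> box_coords B y' -> colsum y = colsum y' -> y = y'.
Proof.
by move=> sA sB yA yB e; rewrite (box_coords_canon sA yA) e -(box_coords_canon sB yB).
Qed.

Lemma cell_sum A x : box_cell A x -> \sum_v x 0 v = d%:R.
Proof.
move=> [y [_ _ y1] ->]; under eq_bigr do rewrite mxE.
by rewrite exchange_big /= (eq_bigr (fun=> 1)) // sumr_const card_ord.
Qed.

Lemma cell_ge0 A x v : box_cell A x -> 0 <= x 0 v.
Proof. by move=> [y [y0 _ _] ->]; rewrite mxE sumr_ge0. Qed.

Definition support_box y : box := [set p | y p.1 p.2 != 0]%SET.

Section CanonicalCoords.
Variable x : V.
Hypotheses (x0 : forall v, 0 <= x 0 v) (x1 : \sum_v x 0 v = d%:R).

Lemma canon_ge0 j v : 0 <= canon_coords x j v.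
Proof. by rewrite mxE subr_ge0 le_clamp // lerD2r le_psum. Qed.

Lemma canon_row j : \sum_v canon_coords x j v = 1.
Proof.
under eq_bigr do rewrite mxE.
rewrite -(big_mkord xpredT (fun k : nat =>
  clamp (psum x k.+1 - j%:R) - clamp (psum x k - j%:R))).
rewrite telescope_sumr // psum0 psum_full x1 clamp_ge1 ?clamp_le0 ?subr0 //.
  by rewrite sub0r oppr_le0.
by rewrite -natrB ?(ltnW (ltn_ord j)) // ler1n subn_gt0.
Qed.

Lemma psum_bounds k : 0 <= psum x k <= d%:R.
Proof.
rewrite sumr_ge0 //= -x1 [leRHS](bigID (fun u : 'I_n => (u < k)%N)).
by rewrite lerDl sumr_ge0.
Qed.

Lemma colsum_canon : colsum (canon_coords x) = x.
Proof.
apply/rowP => v; rewrite mxE; under eq_bigr do rewrite mxE.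
have /andP[p0 p1] := psum_bounds v.+1; have /andP[q0 q1] := psum_bounds v.
rewrite sumrB !sum_clamp // (min_idPl p1) (min_idPl q1) psumS; ring.
Qed.

Lemma valid_support_canon : valid_box (support_box (canon_coords x)).
Proof.
apply/andP; split.
  apply/sorted_boxP => -[i u] [j v]; rewrite !inE !mxE /= => iu jv ij.
  rewrite -ltnS ltnNge; apply/negP => vu.
  have := le_psum x0 vu => le_vu.
  have ij1 : i%:R + 1 <= j%:R :> R by rewrite natr1 ler_nat.
  (* Column [v] ends before column [u] begins. If it ends by [j], it misses [j, j + 1]; otherwise
     column [u] starts beyond [i + 1] and misses [i, i + 1]. *)
  have [h|h] := leP (psum x v.+1) j%:R.
    case/eqP: jv; rewrite !clamp_le0 ?subrr // subr_le0 //.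
    by apply: le_trans h; apply: le_psum.
  case/eqP: iu; rewrite !clamp_ge1 ?subrr //; first by lra.
  by have := le_psum x0 (leqnSn u); lra.
apply/full_boxP => j; apply/existsP; apply: contraPT (canon_row j) => /existsPn h.
rewrite big1 => [/eqP|v _]; first by rewrite eq_sym oner_eq0.
by have := h v; rewrite inE negbK => /eqP.
Qed.

Lemma support_canon_coords : box_coords (support_box (canon_coords x)) (canon_coords x).
Proof.
split; [exact: canon_ge0 | | exact: canon_row].
by move=> j v; rewrite inE negbK => /eqP.
Qed.

Lemma support_canon_cell : box_cell (support_box (canon_coords x)) x.
Proof. by exists (canon_coords x);
  [exact: support_canon_coords | rewrite colsum_canon]. Qed.

End CanonicalCoords.

Lemma box_coordsS A B y : A \subset B -> box_coords A y -> box_coords B y.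
Proof.
move=> /fintype.subsetP AB [y0 yA y1]; split=> // j v; move/contra: (AB (j, v)) => h.
by move=> /h/yA.
Qed.

Lemma cellS A B : A \subset B -> box_cell A `<=` box_cell B.
Proof. by move=> AB x [y yA ->]; exists y => //; apply: box_coordsS yA. Qed.

Lemma cellI A B : sorted_box A -> sorted_box B -> box_cell A `&` box_cell B =
  box_cell (A :&: B).
Proof.
move=> sA sB; apply/seteqP; split => x; last first.
  by move=> h; split; [apply: (cellS (subsetIl A B)) | apply: (cellS (subsetIr A B))].
move=> [[y yA ->] [y' yB e]]; exists y => //.
have yy := sorted_coords_inj sA sB yA yB e; rewrite -yy in yB.
have [y0 hA y1] := yA; have [_ hB _] := yB; split=> // j v.
by rewrite finset.in_setI negb_and => /orP[/hA|/hB].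
Qed.

Lemma cell_not_full A : ~~ full_box A -> box_cell A = set0.
Proof.
move=> nA; apply/seteqP; split => // x [y [_ yA y1] _]; case/negP: nA.
apply/full_boxP => j; apply/existsP; apply: contraPT (y1 j) => /existsPn h.
rewrite big1 => [/eqP|v _]; first by rewrite eq_sym oner_eq0.
by rewrite yA.
Qed.

Definition sel_coords (m : 'I_d -> 'I_n) : 'M[R]_(d, n) := \matrix_(j, v) (v == m j)%:R.

Lemma sel_coordsP m : box_coords (sel_box m) (sel_coords m).
Proof.
split=> [j v|j v|j]; first by rewrite mxE ler0n.
  by rewrite in_sel_box mxE => /negbTE ->.
under eq_bigr do rewrite mxE.
by rewrite -natr_sum (bigD1 (m j)) //= eqxx big1 // => v /negbTE ->.
Qed.

Definition sel_point m : V := colsum (sel_coords m).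

Lemma sel_point_cell A m : sel_box m \subset A -> box_cell A (sel_point m).
Proof. by move=> /cellS; apply; exists (sel_coords m) => //; apply: sel_coordsP. Qed.

Lemma cell_sel_box m : box_cell (sel_box m) = [set sel_point m].
Proof.
apply/seteqP; split => [x [y [_ yA y1] ->]|x ->]; last exact: sel_point_cell.
congr colsum; apply/matrixP => j v; rewrite mxE; have := y1 j.
have y0 u : u != m j -> y j u = 0 by move=> h; apply: yA; rewrite in_sel_box.
rewrite (bigD1 (m j)) //= big1 ?addr0 // => e.
by case: eqVneq => [->|/y0].
Qed.

Lemma cell_nonempty A : full_box A -> box_cell A !=set0.
Proof.
move=> /full_boxP fA; pose m j := xchoose (fA j).
exists (sel_point m); apply/sel_point_cell/fintype.subsetP => -[j u].
by rewrite in_sel_box => /eqP ->; exact: (xchooseP (fA j)).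
Qed.

(** Each pair of [A] is used by a vertex of its cell, whose coordinates are unique and therefore
    supported in [B]. *)
Lemma cell_subset A B : valid_box A -> sorted_box B -> box_cell A `<=` box_cell B -> A \subset B.
Proof.
move=> vA sB AB; apply/fintype.subsetP => -[j v] pA.
have /andP[_ fA] := vA.
have [m [mA /= mj]] := full_box_sel_through fA pA.
have /andP[sm _] := valid_sel_box vA mA.
have [y' yB e] := AB _ (sel_point_cell mA).
have ee := sorted_coords_inj sm sB (sel_coordsP m) yB e.
have [_ hB _] := yB; apply/negPn/negP => /hB/eqP.
by rewrite -ee mxE mj eqxx oner_eq0.
Qed.

Lemma cell_inj A B : valid_box A -> valid_box B -> box_cell A = box_cell B -> A = B.
Proof.
move=> vA vB e; have /andP[sA _] := vA; have /andP[sB _] := vB.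
by apply/eqP; rewrite finset.eqEsubset (cell_subset vA sB) ?e // (cell_subset vB sA) ?e.
Qed.

End Cells.

Arguments box_cell R {d n} A _.

(** * Polytopes and affine dimension *)

Section ConvexAffine.
Variables (R : realType) (N : nat).
Local Notation V := 'rV[R]_N.

Lemma is_polytope_weights (I : finType) (Q : {set I}) (p : I -> V) :
  is_polytope [set x : V | exists a : I -> R,
    [/\ forall i, 0 <= a i, forall i, i \notin Q -> a i = 0,
        \sum_i a i = 1 & x = \sum_i a i *: p i]].
Proof.
exists #|Q|, (fun k => p (enum_val k)); apply/seteqP; split => x.
  move=> [a [a0 aQ a1 ->]]; exists (fun k => a (enum_val k)).
  have sumQ (W : nmodType) (F : I -> W) : (forall i, i \notin Q -> F i = 0) ->
      \sum_i F i = \sum_(k < #|Q|) F (enum_val k).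
    move=> F0; rewrite -(big_enum_val F) [LHS](bigID (mem Q)) /= [X in _ + X]big1 ?addr0 //.
  split=> //; first by rewrite -sumQ.
  by apply: (sumQ _ (fun i => a i *: p i)) => i /aQ ->; rewrite scale0r.
move=> [a [a0 a1 ->]]; pose b i := \sum_(k | enum_val k == i :> I) a k.
exists b; split.
- by move=> i; apply: sumr_ge0.
- move=> i iQ; apply: big1 => k /eqP e.
  by case/negP: iQ; rewrite -e enum_valP.
- by rewrite -a1 [RHS](partition_big (fun k => enum_val k) predT).
- rewrite (partition_big (fun k => enum_val k) predT) //=; apply: eq_bigr => i _.
  by rewrite scaler_suml; apply: eq_bigr => k /eqP ->.
Qed.

Lemma nontrivial_left_kernel (m k : nat) (W : 'M[R]_(m, k)) : (k < m)%N ->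
  exists2 a : 'rV[R]_m, a != 0 & a *m W = 0.
Proof.
move=> km; have : kermx W != 0.
  rewrite -mxrank_eq0 mxrank_ker subn_eq0 -ltnNge.
  exact: leq_ltn_trans (rank_leq_col W) km.
by case/rowV0Pn => a aW nz; exists a => //; apply/sub_kermxP.
Qed.

(** A prepended coordinate 1 turns affine dependence into linear dependence. Hence the range of the
    maximum in [affdim] is large enough. *)
Lemma affinely_independent_leq (m : nat) (p : 'I_m -> V) :
  affinely_independent p -> (m <= N.+1)%N.
Proof.
move=> ind; rewrite leqNgt; apply/negP => Nm.
pose W : 'M[R]_(m, 1 + N) := row_mx (const_mx 1) (\matrix_i p i).
have [//|a anz aW] := @nontrivial_left_kernel m (1 + N) W.
move: aW; rewrite mul_mx_row => /eqP; rewrite row_mx_eq0 => /andP[/eqP e1 /eqP e2].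
case/eqP: anz; apply/rowP => i; rewrite mxE; apply: (ind (a 0)).
  have /matrixP/(_ 0 0) := e1; rewrite !mxE => h; rewrite -[RHS]h.
  by apply: eq_bigr => k _; rewrite mxE mulr1.
by rewrite -[RHS]e2 mulmx_sum_row; apply: eq_bigr => k _; rewrite rowK.
Qed.

(** Computes [affdim] from an affine frame of [A]: the origin [x0] and the directions [u t],
    linearly independent and spanning. *)
Lemma affdim_base (I : finType) (D : {set I}) (A : set V) (x0 : V) (u : I -> V) :
  A x0 -> (forall t, t \in D -> A (x0 + u t)) ->
  (forall a : I -> R, \sum_(t in D) a t *: u t = 0 -> forall t, t \in D -> a t = 0) ->
  (forall x, A x -> exists w : I -> R, x = x0 + \sum_(t in D) w t *: u t) ->
  affdim A = #|D|%:Z.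
Proof.
move=> Ax0 Au ind span; rewrite /affdim.
suff -> : (\max_(m < N.+2 | `[< exists p : 'I_m -> V,
      (forall i, A (p i)) /\ affinely_independent p >]) (m : nat))%N = #|D|.+1.
  by rewrite -addn1 PoszD addrK.
pose p (i : 'I_#|D|.+1) := if unlift ord0 i is Some k then x0 + u (enum_val k) else x0.
have Ap i : A (p i) by rewrite /p; case: unliftP => // k _; apply/Au/enum_valP.
have ind_p : affinely_independent p.
  move=> a a0 ap.
  have e0 : p ord0 = x0 by rewrite /p unlift_none.
  have eS k : p (lift ord0 k) = x0 + u (enum_val k) by rewrite /p liftK.
  pose b t := if [pick k | enum_val k == t :> I] is Some k then a (lift ord0 k) else 0.
  have bE k : b (enum_val k) = a (lift ord0 k).
    by rewrite /b; case: pickP => [k' /eqP/enum_val_inj -> //|/(_ k)]; rewrite eqxx.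
  have bD : forall t, t \in D -> b t = 0.
    apply: ind; rewrite big_enum_val /=.
    move: ap; rewrite big_ord_recl e0 (eq_bigr (fun k =>
      a (lift ord0 k) *: x0 + a (lift ord0 k) *: u (enum_val k))) => [|k _]; last first.
      by rewrite eS scalerDr.
    rewrite big_split /= -scaler_suml addrA -scalerDl -(big_ord_recl _ a) a0 scale0r add0r => e.
    by rewrite -[RHS]e; apply: eq_bigr => k _; rewrite bE.
  have aS k : a (lift ord0 k) = 0 by rewrite -bE bD ?enum_valP.
  move=> i; case: (unliftP ord0 i) => [k ->|->] //.
  by move: a0; rewrite big_ord_recl big1 ?addr0.
have DN : (#|D|.+1 < N.+2)%N by apply: affinely_independent_leq ind_p.
apply/eqP; rewrite eqn_leq; apply/andP; split; last first.
  apply: (leq_bigmax_cond (F := fun m : 'I_N.+2 => m : nat) (Ordinal DN)).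
  by apply/asboolP; exists p.
apply/bigmax_leqP => m /asboolP[q [Aq ind_q]]; rewrite leqNgt; apply/negP => Dm.
have [w hw] := boolp.choice (fun i => span _ (Aq i)).
(* More than [#|D|.+1] points of [A] have dependent coordinate vectors once a 1 is prepended. *)
pose W : 'M[R]_(m, 1 + #|D|) := row_mx (const_mx 1) (\matrix_(i, k) w i (enum_val k)).
have [//|a anz aW] := @nontrivial_left_kernel _ _ W.
move: aW; rewrite mul_mx_row => /eqP; rewrite row_mx_eq0 => /andP[/eqP e1 /eqP e2].
have a0 : \sum_i a 0 i = 0.
  have /matrixP/(_ 0 0) := e1; rewrite !mxE => h; rewrite -[RHS]h.
  by apply: eq_bigr => k _; rewrite mxE mulr1.
case/eqP: anz; apply/rowP => i; rewrite mxE; apply: (ind_q (a 0)) => //.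
under eq_bigr => k _ do rewrite hw scalerDr scaler_sumr.
rewrite big_split /= -scaler_suml a0 scale0r add0r exchange_big /= big1 // => t tD.
under eq_bigr => k _ do rewrite scalerA.
rewrite -scaler_suml; have /matrixP/(_ 0 (enum_rank_in tD t)) := e2.
rewrite !mxE => e; suff -> : \sum_k a 0 k * w k t = 0 by rewrite scale0r.
by rewrite -[RHS]e; apply: eq_bigr => k _; rewrite mxE enum_rankK_in.
Qed.

Lemma affdim_set0 : affdim (set0 : set V) = -1.
Proof.
rewrite /affdim big1 // => -[[//|m] hm] /asboolP[p [/(_ ord0)]] //.
Qed.

End ConvexAffine.

(** * Cells as polytopes: vertices, faces and dimension *)

Section CellGeometry.
Variables (R : realType) (d n : nat).
Local Notation box := {set 'I_d * 'I_n}.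
Local Notation V := 'rV[R]_n.
Implicit Types (A B Z : box) (p q : 'I_d * 'I_n) (j : 'I_d) (v : 'I_n).
Implicit Types (x : V) (y : 'M[R]_(d, n)) (c : 'cV[R]_n).

(* The weights are the product measures: the vertices of a Minkowski sum of
   simplices are obtained by choosing one vertex in each summand. *)
Lemma is_polytope_cell A : is_polytope (box_cell R A).
Proof.
move: (is_polytope_weights
  [set phi : {ffun 'I_d -> 'I_n} | sel_box phi \subset A]%SET
  (fun phi : {ffun 'I_d -> 'I_n} => sel_point R phi)).
set P := (X in is_polytope X); suff -> : P = box_cell R A by [].
rewrite {}/P; apply/seteqP; split => x.
  move=> [a [a0 aQ a1 ->]].
  exists (\matrix_(j, v) \sum_phi a phi * (v == phi j)%:R).
    split=> [j v|j v jA|j].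
    - by rewrite mxE sumr_ge0 // => phi _; rewrite mulr_ge0 // ler0n.
    - rewrite mxE big1 // => phi _; have [e|_] := eqVneq; last by rewrite mulr0.
      rewrite aQ ?mul0r // inE; apply: contra jA => /fintype.subsetP; apply.
      by rewrite in_sel_box e.
    - under eq_bigr do rewrite mxE.
      rewrite exchange_big -[RHS]a1 /=; apply: eq_bigr => phi _.
      rewrite -mulr_sumr (bigD1 (phi j)) //= eqxx big1 ?addr0 ?mulr1 //.
      by move=> v /negbTE ->.
  apply/rowP => v; rewrite summxE mxE; under [RHS]eq_bigr do rewrite mxE.
  rewrite exchange_big; apply: eq_bigr => phi _; rewrite !mxE mulr_sumr.
  by apply: eq_bigr => j _; rewrite mxE.
move=> [y [y0 yA y1] ->]; exists (fun phi : {ffun 'I_d -> 'I_n} =>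
  \prod_j y j (phi j)); split.
- by move=> phi; apply: prodr_ge0.
- move=> phi; rewrite inE => /subsetPn[[j v]]; rewrite in_sel_box => /eqP -> nA.
  by rewrite (bigD1 j) //= yA // mul0r.
- by rewrite -(bigA_distr_bigA (fun j v => y j v)) big1.
- apply/rowP => v; rewrite summxE mxE.
  under [RHS]eq_bigr => phi _ do rewrite !mxE mulr_sumr.
  rewrite exchange_big; apply: eq_bigr => j _ /=.
  (* The marginal of the product measure in row [j]: the indicator of [v] enters that factor only,
     and the other factors sum to 1. *)
  pose F i u := if i == j then y i u * (v == u)%:R else y i u.
  transitivity (\prod_i \sum_u F i u).
    rewrite (bigD1 j) //= [X in _ * X]big1 ?mulr1 => [|i ij]; last first.
      by rewrite /F (negbTE ij) y1.
    rewrite /F eqxx (bigD1 v) //= eqxx mulr1 big1 ?addr0 // => u uv.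
    by rewrite eq_sym (negbTE uv) mulr0.
  rewrite bigA_distr_bigA; apply: eq_bigr => phi _.
  rewrite (bigD1 j) //= [X in _ = X * _](bigD1 j) //= /F eqxx mxE mulrAC.
  by congr (_ * _ * _); apply: eq_bigr => i /negbTE ->.
Qed.

Lemma colsum_dot y c : (colsum y *m c) 0 0 = \sum_j \sum_v y j v * c v 0.
Proof.
rewrite mxE; under eq_bigr => v _ do rewrite mxE mulr_suml.
by rewrite exchange_big.
Qed.

(* On a sorted box, [c] is constant on every row but [j], because [v] separates
   the earlier rows from the later ones whenever it ends row [j]. *)
Lemma coord_functional A p : sorted_box A -> p \in A ->
  exists c, exists b : R, forall y, box_coords A y ->
    (colsum y *m c) 0 0 = b - y p.1 p.2.
Proof.
case: p => j v /sorted_boxP sA jvA /=.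
pose ismin := [forall w, ((j, w) \in A) ==> (v <= w)%N].
pose ismax := [forall w, ((j, w) \in A) ==> (w <= v)%N].
(* An earlier row lies in columns at most [v] and can reach [v] only if [v] is the minimum of row
   [j]. Then extending the indicator of [v] to all smaller columns makes it constant on that row
   without changing row [j]. Later rows are symmetric, with the maximum. *)
pose gam (u : 'I_n) : bool := [|| u == v, (u < v)%N && ismin | (v < u)%N && ismax].
pose kap (i : 'I_d) : R := - (if (i < j)%N then ismin else ismax)%:R.
exists (\col_u - (gam u)%:R), (\sum_(i | i != j) kap i) => y [y0 yA y1].
rewrite colsum_dot (bigD1 j) //= addrC; congr (_ + _).
  apply: eq_bigr => i ij.
  transitivity (\sum_u y i u * kap i); last by rewrite -mulr_suml y1 mul1r.
  apply: eq_bigr => u _; rewrite mxE.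
  have [iuA|/yA ->] := boolP ((i, u) \in A); last by rewrite !mul0r.
  rewrite /kap; suff -> : gam u = (if (i < j)%N then ismin else ismax) by [].
  rewrite /gam; case: (ltngtP i j) => [lij|gij|/val_inj e]; last by rewrite e eqxx in ij.
    have uv : (u <= v)%N by apply: (sA _ _ iuA jvA).
    rewrite [(v < u)%N]ltnNge uv /= orbF; case: eqVneq => [e|ne] /=.
      by apply/esym/forallP => w; apply/implyP => jw; rewrite -e; apply: (sA _ _ iuA jw).
    by rewrite ltn_neqAle ne uv.
  have uv : (v <= u)%N by apply: (sA _ _ jvA iuA).
  rewrite [(u < v)%N]ltnNge uv /=; case: eqVneq => [e|ne] /=.
    by apply/esym/forallP => w; apply/implyP => jw; rewrite -e; apply: (sA _ _ jw iuA).
  by rewrite ltn_neqAle eq_sym ne uv.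
rewrite (bigD1 v) //= mxE /gam eqxx /= mulrN1 big1 ?addr0 // => u uv.
have [juA|/yA ->] := boolP ((j, u) \in A); last by rewrite mul0r.
rewrite mxE (negbTE uv) /=.
have [lt|_] /= := ltnP u v.
  rewrite ltnNge (ltnW lt) /= orbF; case: (boolP ismin) => [/forallP/(_ u)|];
    last by rewrite oppr0 mulr0.
  by rewrite juA /= leqNgt lt.
have [lt|_] /= := ltnP v u; last by rewrite oppr0 mulr0.
case: (boolP ismax) => [/forallP/(_ u)|]; last by rewrite oppr0 mulr0.
by rewrite juA /= leqNgt lt.
Qed.

(** The functionals of the pairs in [A :\: B] add up to a constant minus the total weight outside
    [B], which is maximal exactly where that weight vanishes. *)
Lemma is_face_subcell A B : sorted_box A -> B \subset A -> is_face (box_cell R B) (box_cell R A).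
Proof.
move=> sA BA.
have /boolp.choice[cb hcb] : forall p, exists cb : 'cV[R]_n * R, p \in A ->
    forall y, box_coords A y -> (colsum y *m cb.1) 0 0 = cb.2 - y p.1 p.2.
  move=> p; have [pA|npA] := boolP (p \in A); last by exists (0, 0).
  by have [c [b h]] := coord_functional sA pA; exists (c, b).
pose c := \sum_(p in A :\: B) (cb p).1; pose b := \sum_(p in A :\: B) (cb p).2.
have key y : box_coords A y ->
    (colsum y *m c) 0 0 = b - \sum_(p in A :\: B) y p.1 p.2.
  move=> yA; rewrite mulmx_sumr summxE -sumrB; apply: eq_bigr => p.
  by rewrite finset.in_setD => /andP[_ pA]; apply: hcb.
exists c, b; split=> [x [y yA ->]|].
  by rewrite key // gerBl sumr_ge0 // => p _; case: yA.
apply/seteqP; split => [x [y yB ->]|x [[y yA ->] /=]].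
  have yA := box_coordsS BA yB; split; first by exists y.
  rewrite /= key // big1 ?subr0 // => -[j v]; rewrite finset.in_setD => /andP[jB _].
  by case: yB => _ h _; apply: h.
rewrite key // => e.
have s0 : \sum_(p in A :\: B) y p.1 p.2 = 0 by lra.
have y0 := psumr_eq0P (fun p _ => let: And3 h _ _ := yA in h p.1 p.2) s0.
exists y => //; have [yge yA0 y1] := yA; split=> // j v jB.
have [jA|/yA0//] := boolP ((j, v) \in A).
by apply: (y0 (j, v)); rewrite finset.in_setD jB.
Qed.

(* The face of a Minkowski sum on which a linear form is maximal is the sum of
   the faces of the summands on which it is maximal. *)
Lemma face_box_cell A F : full_box A -> is_face F (box_cell R A) ->
  F = set0 \/ exists2 B : box, B \subset A & full_box B /\ F = box_cell R B.
Proof.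
move=> /full_boxP fA [c [b [le_b ->]]].
set F0 := _ `&` _; have [F0e|/set0P[x0 Fx0]] := eqVneq F0 set0; first by left.
right.
have arg j : {w | (j, w) \in A & forall u, (j, u) \in A -> c u 0 <= c w 0}.
  case: (arg_maxP (P := fun u => (j, u) \in A) (fun u => c u 0) (xchooseP (fA j))).
  by move=> w jw hw; exists w.
pose mu j := s2val (arg j).
have muA j : (j, mu j) \in A := s2valP (arg j).
have mu_max j u : (j, u) \in A -> c u 0 <= c (mu j) 0 := s2valP' (arg j) u.
pose B : box := [set p in A | c p.2 0 == c (mu p.1) 0]%SET.
have BA : B \subset A by apply/fintype.subsetP => p; rewrite inE => /andP[].
have selB : sel_box mu \subset B.
  by apply/fintype.subsetP => -[j v]; rewrite in_sel_box => /eqP ->;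
    rewrite inE /= muA eqxx.
have gap y : box_coords A y ->
    \sum_j c (mu j) 0 - (colsum y *m c) 0 0 = \sum_j \sum_v y j v * (c (mu j) 0 - c v 0).
  move=> [_ _ y1]; rewrite colsum_dot -sumrB; apply: eq_bigr => j _.
  under [RHS]eq_bigr do rewrite mulrBr.
  by rewrite sumrB -mulr_suml y1 mul1r.
have gap0 y : box_coords A y -> forall j v, 0 <= y j v * (c (mu j) 0 - c v 0).
  move=> [y0 yA _] j v; have [jA|/yA ->] := boolP ((j, v) \in A); last by rewrite mul0r.
  by rewrite mulr_ge0 // subr_ge0 mu_max.
(* As the face is nonempty, [b] is the true maximum, attained at the vertex selected by [mu]. *)
have bE : b = \sum_j c (mu j) 0.
  apply/eqP; rewrite eq_le; apply/andP; split.
    case: Fx0 => -[y yA ->] /= <-; rewrite -subr_ge0 gap //.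
    by apply: sumr_ge0 => j _; apply: sumr_ge0 => v _; apply: gap0.
  have := le_b _ (sel_point_cell R (fintype.subset_trans selB BA)); congr (_ <= _).
  apply/eqP; rewrite eq_sym -subr_eq0 gap; last first.
    exact: box_coordsS (fintype.subset_trans selB BA) (sel_coordsP R mu).
  apply/eqP; apply: big1 => j _; apply: big1 => v _; rewrite mxE.
  by case: eqVneq => [->|_]; rewrite ?subrr ?mulr0 ?mul0r.
exists B => //; split; first by apply: full_boxS selB _; apply: full_sel_box.
apply/seteqP; split => x.
  move=> [[y yA ->] /= e]; exists y => //; have [y0 yA0 y1] := yA; split=> // j v.
  have [jA|/yA0//] := boolP ((j, v) \in A); rewrite inE jA /= => ne.
  have := gap y yA; rewrite e bE subrr => /esym.
  move=> /psumr_eq0P-/(_ (fun j _ => sumr_ge0 _ (fun v _ => gap0 y yA j v)) j isT).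
  move=> /psumr_eq0P-/(_ (fun v _ => gap0 y yA j v) v isT) /eqP.
  by rewrite mulf_eq0 subr_eq0 [c (mu j) 0 == _]eq_sym (negbTE ne) orbF => /eqP.
move=> [y yB ->]; have yA := box_coordsS BA yB; split; first by exists y.
apply/esym/eqP; rewrite /= bE -subr_eq0 gap //; apply/eqP; apply: big1 => j _;
  apply: big1 => v _.
have [|jB] := boolP ((j, v) \in B); last by case: yB => _ -> //; rewrite mul0r.
by rewrite inE => /andP[_ /eqP ->]; rewrite subrr mulr0.
Qed.

Lemma colsumD y z : colsum (y + z) = colsum y + colsum z.
Proof.
by apply/rowP => v; rewrite !mxE -big_split; apply: eq_bigr => j _; rewrite mxE.
Qed.

Lemma colsumZ (a : R) y : colsum (a *: y) = a *: colsum y.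
Proof.
by apply/rowP => v; rewrite !mxE mulr_sumr; apply: eq_bigr => j _; rewrite mxE.
Qed.

Lemma colsum_lin (I : finType) (D : {set I}) (a : I -> R) (y : I -> 'M[R]_(d, n)) :
  colsum (\sum_(t in D) a t *: y t) = \sum_(t in D) a t *: colsum (y t).
Proof.
elim/big_rec2: _ => [|t x z _ <-]; last by rewrite colsumD colsumZ.
by apply/rowP => v; rewrite !mxE big1 // => j _; rewrite mxE.
Qed.

(** The frame starts at a vertex [m] of the cell; each pair outside [sel_box m] changes one row of
    it. [coord_functional] reads off the coefficients, which gives independence. *)
Lemma affdim_box_cell A : valid_box A -> affdim (box_cell R A) = #|A|%:Z - d%:Z.
Proof.
move=> vA; have /andP[sA _] := vA; have [m mA _] := valid_box_sel vA.
pose upd p j := if j == p.1 then p.2 else m j.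
pose D := A :\: sel_box m.
have updA p : p \in D -> sel_box (upd p) \subset A.
  rewrite finset.in_setD => /andP[_ pA]; apply/fintype.subsetP => -[j v].
  rewrite in_sel_box /upd => /eqP ->; case: eqVneq => [->|_].
    by rewrite -surjective_pairing.
  by apply: (fintype.subsetP mA); rewrite in_sel_box.
pose u p : 'M[R]_(d, n) := sel_coords R (upd p) - sel_coords R m.
have uE p j v : (j, v) \in D -> p \in D -> u p j v = (p == (j, v))%:R.
  rewrite !finset.in_setD !inE !mxE /= => /andP[vm _] _.
  rewrite (negbTE vm) subr0 /upd; congr (_%:R); congr nat_of_bool.
  case: p => i w /=; rewrite xpair_eqE; case: (eqVneq j i) => _ /=.
    by rewrite eq_sym.
  exact: negbTE.
have -> : #|A|%:Z - d%:Z = #|D|%:Z.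
  rewrite /D cardsD (finset.setIidPr mA) card_sel_box subzn //.
  exact: card_valid_box.
apply: (affdim_base (x0 := sel_point R m) (u := fun p => colsum (u p))).
- exact: sel_point_cell.
- move=> p pD; rewrite -colsumD /u addrC subrK; exact/sel_point_cell/updA.
- move=> a a0 [j v] jD.
  have jA : (j, v) \in A by move: jD; rewrite finset.in_setD => /andP[].
  have [c [b hc]] := coord_functional sA jA.
  have hu p : p \in D -> (colsum (u p) *m c) 0 0 = - (p == (j, v))%:R.
    move=> pD; have e : colsum (u p) = sel_point R (upd p) - sel_point R m.
      by rewrite /u colsumD -scaleN1r colsumZ scaleN1r.
    rewrite e mulmxBl mxE [X in _ + X]mxE.
    rewrite (hc _ (box_coordsS (updA _ pD) (sel_coordsP R _))) (hc _ (box_coordsS mA (sel_coordsP R _))).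
    by rewrite -(uE p j v) // !mxE /=; ring.
  have := congr1 (fun x : V => (x *m c) 0 0) a0.
  rewrite /= mulmx_suml mul0mx [RHS]mxE summxE (bigD1 (j, v)) //= big1 ?addr0.
    rewrite -scalemxAl mxE hu // eqxx mulrN1 => /eqP.
    by rewrite oppr_eq0 => /eqP.
  move=> p /andP[pD pj]; rewrite -scalemxAl mxE hu // (negbTE pj) oppr0 mulr0 //.
- move=> x [y yA ->]; exists (fun p => y p.1 p.2).
  rewrite -colsum_lin -colsumD; congr colsum; apply/matrixP.
  set z := _ + _.
  (* Both matrices have row sums 1, so agreement off the selection [m] implies agreement on it. *)
  have zrow j : \sum_v z j v = 1.
    under eq_bigr do rewrite mxE summxE.
    rewrite big_split /= [X in _ + X]exchange_big /= [X in _ + X]big1 ?addr0 => [|p _].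
      by have [_ _ ->] := sel_coordsP R m.
    have [_ _ r1] := sel_coordsP R m; have [_ _ r2] := sel_coordsP R (upd p).
    have u0 : \sum_v u p j v = 0.
      under eq_bigr do rewrite mxE [X in _ + X]mxE.
      by rewrite sumrB r1 r2 subrr.
    under eq_bigr do rewrite mxE.
    by rewrite -mulr_sumr u0 mulr0.
  have zD j v : v != m j -> z j v = y j v.
    move=> vm; rewrite mxE summxE [X in X + _]mxE (negbTE vm) add0r.
    have [jD|jD] := boolP ((j, v) \in D).
      rewrite (bigD1 (j, v)) //= mxE uE // eqxx mulr1 big1 ?addr0 // => p /andP[pD pj].
      by rewrite mxE uE // (negbTE pj) mulr0.
    have jA : (j, v) \notin A by move: jD; rewrite finset.in_setD in_sel_box vm.
    have [_ -> // _] := yA; apply: big1 => p pD; rewrite mxE.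
    have pA : p \in A by move: pD; rewrite finset.in_setD => /andP[].
    rewrite !mxE (negbTE vm) subr0 /upd; case: (eqVneq j p.1) => [e|_].
      case: (eqVneq v p.2) => [e'|_]; last by rewrite mulr0.
      by case/negP: jA; rewrite e e' -surjective_pairing.
    by rewrite (negbTE vm) mulr0.
  move=> j v; have [->|/zD//] := eqVneq v (m j).
  have := zrow j; have [_ _ /(_ j)] := yA; rewrite (bigD1 (m j)) //= => <-.
  rewrite (bigD1 (m j)) //= (eq_bigr (fun v => y j v)).
    by move/addIr.
  by move=> w /zD.
Qed.

End CellGeometry.

(** * Powers of the maximal ideal *)

Section Ideals.
Variables (K : fieldType) (n : nat).
Local Notation S := {mpoly K[n]}.
Implicit Types (f g : S) (I J : set S) (m : 'X_{1..n}).

Definition is_ideal I : Prop :=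
  [/\ I 0, forall f g, I f -> I g -> I (f + g) & forall f g, I g -> I (f * g)].

Lemma ideal_gen_min (A : set S) I : is_ideal I -> A `<=` I -> ideal_gen A `<=` I.
Proof.
move=> [I0 ID IM] AI f [k [a [g [Ag ->]]]].
by elim/big_ind: _ => // i _; apply/IM/AI.
Qed.

Lemma sub_ideal_gen (A : set S) : A `<=` ideal_gen A.
Proof.
move=> f Af; exists 1%N, (fun=> 1), (fun=> f); split=> //.
by rewrite big_ord1 mul1r.
Qed.

Lemma ideal_genP (A : set S) : is_ideal (ideal_gen A).
Proof.
split.
- by exists 0%N, (fun=> 0), (fun=> 0); split=> [[]//|]; rewrite big_ord0.
- move=> f g [k1 [a1 [g1 [A1 ->]]]] [k2 [a2 [g2 [A2 ->]]]].
  exists (k1 + k2)%N, (fun i => match fintype.split i with inl j => a1 j | inr j =>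
    a2 j end),
    (fun i => match fintype.split i with inl j => g1 j | inr j => g2 j end); split.
    by move=> i; case: fintype.split.
  rewrite big_split_ord; congr (_ + _); apply: eq_bigr => i _.
    by rewrite (unsplitK (inl i)).
  by rewrite (unsplitK (inr i)).
- move=> f g [k [a [h [Ah ->]]]]; exists k, (fun i => f * a i), h; split=> //.
  by rewrite mulr_sumr; apply: eq_bigr => i _; rewrite mulrA.
Qed.

Lemma ideal_gen_sum (A : set S) (I : finType) (P : pred I) (F : I -> S) :
  (forall i, P i -> ideal_gen A (F i)) -> ideal_gen A (\sum_(i | P i) F i).
Proof. by have [A0 AD _] := ideal_genP A => h; elim/big_ind: _. Qed.

Lemma is_ideal_quot I g : is_ideal I -> is_ideal [set f | I (f * g)].
Proof.
move=> [I0 ID IM]; split=> [|f h|f h] /=; first by rewrite mul0r.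
  by rewrite mulrDl; apply: ID.
by rewrite -mulrA; apply: IM.
Qed.

Definition degree_monomials (d : nat) : set 'X_{1..n} := [set m | mdeg m = d].

Lemma monomial_ideal_mem (G : set 'X_{1..n}) m : G m -> monomial_ideal G ('X_[m] : S).
Proof. by move=> Gm; apply: sub_ideal_gen; exists m. Qed.

Lemma monomial_ideal_maxideal k f g :
  monomial_ideal (degree_monomials k) f -> maxideal K n g ->
  monomial_ideal (degree_monomials k.+1) (f * g).
Proof.
move=> If Ig; move: f If; apply: ideal_gen_min.
  exact: is_ideal_quot (ideal_genP _).
move=> _ [m mk <-] /=; rewrite mulrC; move: g Ig; apply: ideal_gen_min.
  exact: is_ideal_quot (ideal_genP _).
move=> _ [i _ <-] /=; rewrite -mpolyXD; apply: monomial_ideal_mem.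
by rewrite /degree_monomials /= mdegD mdeg1 add1n mk.
Qed.

Lemma ideal_exp_maxideal d :
  (forall m, mdeg m = d -> exists h : 'I_d -> 'I_n, m = (\sum_j U_(h j))%MM) ->
  ideal_exp (maxideal K n) d = monomial_ideal (degree_monomials d).
Proof.
move=> prodX; apply/seteqP; split; apply: ideal_gen_min; try exact: ideal_genP.
  move=> _ [g [Ig ->]]; elim: d g Ig {prodX} => [|d IH] g Ig.
    rewrite big_ord0 -(mpolyX0); apply: monomial_ideal_mem.
    by rewrite /degree_monomials /= mdeg0.
  rewrite big_ord_recr; apply: monomial_ideal_maxideal => //.
  by apply: IH => i; apply: Ig.
move=> _ [m md <-]; have [h ->] := prodX m md; apply: sub_ideal_gen.
exists (fun j => 'X_(h j)); split; last first.
  exact: (big_morph (fun m => 'X_[m] : S) (fun m1 m2 => mpolyXD K m1 m2) (mpolyX0 n K)).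
by move=> j; apply: sub_ideal_gen; exists (h j).
Qed.

(** A monomial in the ideal of [H] is divisible by one of its generators, and equality of the
    degrees turns divisibility into equality. *)
Lemma min_generators_degree d :
  min_monomial_generators (monomial_ideal (degree_monomials d) : set S)
    (degree_monomials d).
Proof.
split=> // H HG eH; apply/seteqP; split=> // m md.
have : monomial_ideal H ('X_[m] : S) by rewrite eH; apply: monomial_ideal_mem.
move=> [k [a [g [Hg eX]]]]; have := congr1 (mcoeff m) eX.
rewrite mcoeffX eqxx raddf_sum /= => e1.
have [i nz] : exists i, (a i * g i)@_m != 0.
  apply: contrapT => nex; case/eqP: (oner_neq0 K);
    rewrite -[LHS]/(true%:R) e1 big1 // => i _.
  by apply/eqP/negPn/negP => nz; apply: nex; exists i.
have [mi Hmi emi] := Hg i; rewrite -emi in nz.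
have lemi := mcoeffMX_le nz.
suff -> : m = mi by [].
have dmi : mdeg mi = d := HG _ Hmi.
have : mdeg (m - mi)%MM = 0%N.
  have := mdegD (m - mi)%MM mi; rewrite submK // dmi.
  by move: md; rewrite /degree_monomials /= => ->; lia.
move=> /eqP; rewrite mdeg_eq0 => /eqP e; by rewrite -(submK lemi) e add0m.
Qed.

End Ideals.

(** * The complex *)

Section BoxComplex.
Variables (R : realType) (d n : nat).
Hypothesis d_gt0 : (0 < d)%N.
Local Notation box := {set 'I_d * 'I_n}.
Local Notation V := 'rV[R]_n.
Local Notation cell := (@box_cell R d n).
Local Notation box0 := (finset.set0 : box).
Implicit Types (A B Z : box) (p q : 'I_d * 'I_n) (j : 'I_d) (v : 'I_n).
Implicit Types (P F G : set V).

(** [set0] is listed because [is_face] makes it a face of every polytope. *)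
Definition box_complex : {fset (set V)} :=
  seq_fset tt (set0 :: [seq cell A | A <- enum (@valid_box d n)]).

(* The empty face of the complex is the cell of the empty box. *)
Definition face_box A : bool := valid_box A || (A == box0).

Lemma valid_face_box A : valid_box A -> face_box A.
Proof. by rewrite /face_box => ->. Qed.

Lemma face_box0 : face_box box0.
Proof. by rewrite /face_box eqxx orbT. Qed.

Lemma sorted_box0 : sorted_box box0.
Proof. by apply/sorted_boxP => p q; rewrite inE. Qed.

Lemma face_box_sorted A : face_box A -> sorted_box A.
Proof. by case/orP => [/andP[]//|/eqP ->]; apply: sorted_box0. Qed.

Lemma not_full_box0 : ~~ full_box box0.
Proof. by apply/negP => /full_boxP/(_ (Ordinal d_gt0))[v]; rewrite inE. Qed.

Lemma box_cell0 : cell box0 = set0.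
Proof. exact/cell_not_full/not_full_box0. Qed.

Lemma valid_box_neq0 A : valid_box A -> A != box0.
Proof. by case/andP => _ fA; apply: contraTneq fA => ->; apply: not_full_box0. Qed.

Lemma box_complexP F :
  reflect (exists2 A, face_box A & F = cell A) (F \in box_complex).
Proof.
rewrite seq_fsetE inE; apply: (iffP orP) => [[/eqP ->|/mapP[A]]|[A /orP[vA|/eqP ->] ->]].
- by exists box0; [exact: face_box0 | rewrite box_cell0].
- by rewrite mem_enum => vA ->; exists A => //; apply: valid_face_box.
- by right; apply: map_f; rewrite mem_enum.
- by left; rewrite box_cell0.
Qed.

Lemma cell_in_complex A : face_box A -> cell A \in box_complex.
Proof. by move=> fA; apply/box_complexP; exists A. Qed.

Lemma face_cell_sub A B : face_box A -> sorted_box B -> cell A `<=` cell B -> A \subset B.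
Proof.
move=> /orP[vA sB|/eqP -> _ _]; first exact: cell_subset.
by apply/fintype.subsetP => p; rewrite inE.
Qed.

Lemma face_cell_inj A B : face_box A -> face_box B -> cell A = cell B -> A = B.
Proof.
move=> fA fB e; apply/eqP; rewrite finset.eqEsubset.
by rewrite !face_cell_sub ?face_box_sorted // e.
Qed.

Lemma is_face_cell A B : face_box A -> face_box B ->
  is_face (cell B) (cell A) <-> B \subset A.
Proof.
move=> fA fB; split; last exact/is_face_subcell/face_box_sorted.
move=> [c [b [_ e]]]; apply: face_cell_sub => //; first exact: face_box_sorted.
by rewrite e => x [].
Qed.

Lemma face_boxS A B : face_box A -> B \subset A -> full_box B -> face_box B.
Proof.
move=> fA BA fB; rewrite /face_box /valid_box fB andbT.
by rewrite (sorted_boxS BA) // face_box_sorted.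
Qed.

Lemma faces_in_complex F P : P \in box_complex -> is_face F P -> F \in box_complex.
Proof.
case/box_complexP => A fA ->; move: (fA) => /orP[vA|/eqP ->].
  have /andP[_ flA] := vA; case/(face_box_cell flA) => [->|[B BA [fB ->]]].
    by rewrite -box_cell0; apply/cell_in_complex/face_box0.
  by apply: cell_in_complex; apply: face_boxS BA fB.
move=> [c [b [_ ->]]]; rewrite box_cell0 set0I -box_cell0.
exact/cell_in_complex/face_box0.
Qed.

Lemma box_complex_polyhedral : polyhedral_cell_complex box_complex.
Proof.
split.
- apply/fset0Pn; exists (cell box0); exact/cell_in_complex/face_box0.
- by move=> _ /box_complexP[A _ ->]; apply: is_polytope_cell.
- by move=> P F; apply: faces_in_complex.
- move=> _ _ /box_complexP[A /face_box_sorted sA ->] /box_complexP[B /face_box_sorted sB ->].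
  by rewrite cellI //; split; apply: is_face_subcell; rewrite ?subsetIl ?subsetIr.
Qed.

Lemma affdim_cell0 : affdim (cell box0) = -1.
Proof. by rewrite box_cell0 affdim_set0. Qed.

Lemma affdim_cellE A (i : nat) : face_box A ->
  (affdim (cell A) == i%:Z) = valid_box A && (#|A| == i + d)%N.
Proof.
case/orP => [vA|/eqP ->].
  rewrite vA affdim_box_cell // subr_eq /=; by rewrite -PoszD.
by rewrite affdim_cell0 /valid_box (negbTE not_full_box0) andbF.
Qed.

Lemma verticesP P : vertices box_complex P <->
  exists A, [/\ valid_box A, #|A| = d & P = cell A].
Proof.
split=> [[/box_complexP[A fA ->] /eqP]|[A [vA cA ->]]].
  by rewrite affdim_cellE // => /andP[vA /eqP cA]; exists A.
have fA := valid_face_box vA.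
by split; [apply: cell_in_complex | apply/eqP; rewrite affdim_cellE // vA cA /=].
Qed.

Lemma is_facet_cell A B : valid_box A -> valid_box B ->
  is_facet (cell B) (cell A) <-> exists2 p, p \in A & B = A :\ p.
Proof.
move=> vA vB; rewrite /is_facet is_face_cell ?valid_face_box // !affdim_box_cell //.
have sz : (#|A|%:Z - d%:Z = #|B|%:Z - d%:Z + 1) <-> #|A| = #|B|.+1.
  by split; lia.
rewrite sz; split=> [[BA c]|[p pA ->]]; last first.
  by rewrite subD1set; split=> //; rewrite [LHS](cardsD1 p) pA.
have : #|A :\: B| == 1%N by rewrite cardsD (finset.setIidPr BA) c subSnn.
move=> /cards1P[p ep]; have : p \in A :\: B by rewrite ep inE.
rewrite finset.in_setD => /andP[pB pA]; exists p => //.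
by rewrite -ep finset.setDDr finset.setDv finset.set0U (finset.setIidPr BA).
Qed.

Lemma is_facet_cell0 A : valid_box A -> is_facet (cell box0) (cell A) <-> #|A| = d.
Proof.
move=> vA; rewrite /is_facet is_face_cell ?face_box0 ?valid_face_box //.
rewrite affdim_cell0 affdim_box_cell //; split=> [[_]|->]; first by lia.
by split; [apply/fintype.subsetP => p; rewrite inE | rewrite subrr].
Qed.

Lemma not_facet_of_cell0 A : face_box A -> ~ is_facet (cell A) (cell box0).
Proof.
move=> fA [/is_face_cell]; rewrite /face_box eqxx orbT => /(_ isT fA) sA.
have -> : A = box0 by apply/eqP; rewrite -finset.subset0.
by rewrite affdim_cell0.
Qed.

(** The default is the correct value at [set0], since the cell of a valid box is nonempty. *)
Definition box_of P : box :=
  odflt box0 [pick A | valid_box A && `[< cell A = P >]].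

Lemma box_ofK A : face_box A -> box_of (cell A) = A.
Proof.
move=> fA; rewrite /box_of; case: pickP => [B /andP[vB /asboolP e]|h] /=.
  by apply: face_cell_inj => //; apply: valid_face_box.
case/orP: fA => [vA|/eqP -> //]; have := h A; rewrite vA /= => /negbT/asboolPn.
by [].
Qed.

Definition vertex_label P : 'X_{1..n} := box_label (box_of P).

Lemma lem_big_mlcm (I : eqType) (r : seq I) (Q : pred I) (F : I -> 'X_{1..n}) i :
  i \in r -> Q i -> (F i <= \big[@mlcm n/0%MM]_(k <- r | Q k) F k)%MM.
Proof.
move=> + Qi; elim: r => // k r IH; rewrite inE big_cons => /orP[/eqP <-|ir].
  by rewrite Qi lem_mlcml.
by case: ifP => _; rewrite ?(lepm_trans (IH ir)) ?lem_mlcmr ?lepm_refl.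
Qed.

Lemma label_cell A : face_box A -> label box_complex vertex_label (cell A) = box_label A.
Proof.
move=> fA; apply/mnmP => v; apply/eqP; rewrite eqn_leq; apply/andP; split.
  suff /mnm_lepP : (label box_complex vertex_label (cell A) <= box_label A)%MM by apply.
  rewrite /label; elim/big_ind: _ => [|m1 m2 h1 h2|[P /= PX]].
  - by apply/mnm_lepP => u; rewrite mnm0E.
  - by rewrite lem_mlcm h1.
  - case/asboolP => /= _; have [B fB ->] := box_complexP _ PX.
    move=> /(is_face_cell fA fB) BA.
    by rewrite /vertex_label box_ofK // box_label_sub.
case/orP: fA => [vA|/eqP ->]; last first.
  rewrite box_labelE (_ : [set p in box0 | _]%SET = finset.set0) ?cards0 //.
  by apply/setP => p; rewrite !inE.
have /andP[_ flA] := vA; have [m [mA mv]] := full_box_sel v flA.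
have vm := valid_sel_box vA mA; have fm := valid_face_box vm.
have := @lem_big_mlcm _ (index_enum box_complex) (fun x : box_complex =>
    `[< affdim (val x) = 0 /\ is_face (val x) (cell A) >])
  (fun x => vertex_label (val x)) [` cell_in_complex fm]%fset (mem_index_enum _).
move=> /(_ _)/mnm_lepP-/(_ _ v); rewrite /= /vertex_label box_ofK // => le.
apply: leq_trans (le _); last first.
  apply/asboolP; split; last by apply/is_face_cell => //; apply: valid_face_box.
  by rewrite affdim_box_cell // card_sel_box subrr.
rewrite !box_labelE; apply/subset_leq_card/fintype.subsetP => -[j u].
by rewrite !inE => /andP[jA /eqP e]; rewrite e eqxx andbT /= mv // -e.
Qed.

End BoxComplex.

(** * Incidence functions *)

Section Incidence.
Variables (R : realType) (d n : nat).
Hypothesis d_gt0 : (0 < d)%N.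
Local Notation box := {set 'I_d * 'I_n}.
Local Notation V := 'rV[R]_n.
Local Notation cell := (@box_cell R d n).
Local Notation box0 := (finset.set0 : box).
Local Notation X := (box_complex R d n).
Local Notation box_of := (@box_of R d n).
Implicit Types (A B Z : box) (p q : 'I_d * 'I_n) (j : 'I_d) (v : 'I_n).
Implicit Types (P F G : set V).

Lemma incidence_box (K : comNzRingType) (e : set V -> set V -> int) :
  incidence_function X e ->
  box_incidence (fun A B => if valid_box A && valid_box B
                            then (e (cell A) (cell B))%:~R : K else 0).
Proof.
move=> [e_sign e_zero e_vertex e_diamond].
have inX A : valid_box A -> cell A \in X by move=> /valid_face_box;
  apply: cell_in_complex.
have facetD A p : valid_box A -> p \in A -> valid_box (A :\ p) ->
    is_facet (cell (A :\ p)) (cell A).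
  by move=> vA pA vAp; apply/is_facet_cell => //; exists p.
have neqD A p q : valid_box (A :\ p) -> valid_box (A :\ q) -> p \in A -> p != q ->
    cell (A :\ p) <> cell (A :\ q).
  by move=> vp vq pA pq /cell_inj-/(_ vp vq)/(setD1_inj pA)/eqP; rewrite (negbTE pq).
split.
- move=> A p vA pA vAp; rewrite vA vAp /=.
  case: (e_sign (cell A) (cell (A :\ p))); rewrite ?inX //; first exact: facetD.
    by move=> ->; rewrite mulr1.
  by move=> ->; rewrite rmorphN1 mulrNN mulr1.
- move=> A B; case: ifP => [/andP[vA vB] nz|_]; last by rewrite eqxx.
  split=> //; apply/(is_facet_cell R) => //; apply: contrapT => nf.
  by rewrite e_zero ?inX ?eqxx in nz.
- move=> A p q vA pA qA pq vApq; have vAp : valid_box (A :\ p).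
    exact: valid_between vApq (subD1set _ _) (subD1set _ _) vA.
  have sApq : A :\ p :\ q = A :\ q :\ p by rewrite !finset.setDDl finset.setUC.
  have vAq : valid_box (A :\ q).
    by apply: (valid_between vApq _ (subD1set _ _) vA); rewrite sApq subD1set.
  rewrite vA vAp vAq vApq /= -!intrM -intrD e_diamond ?inX //.
  + exact: neqD.
  + exact: facetD.
  + exact: facetD.
  + by apply: facetD => //; rewrite in_setD1 eq_sym pq.
  + by rewrite sApq; apply: facetD; rewrite -?sApq // in_setD1 pq.
- move=> A p q vA cA pA qA pq epq.
  have vAp : valid_box (A :\ p).
    rewrite valid_boxD1 //; apply/facet_pointsP; split=> //; exists q => //.
    by rewrite eq_sym.
  have vAq : valid_box (A :\ q).
    by rewrite valid_boxD1 //; apply/facet_pointsP; split=> //; exists p.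
  have cD r : r \in A -> #|A :\ r| = d.
    by move=> rA; move: cA; rewrite (cardsD1 r) rA => -[].
  have vert r : r \in A -> valid_box (A :\ r) -> e (cell (A :\ r)) set0 = 1.
    by move=> rA vAr; apply/e_vertex/verticesP => //; exists (A :\ r); rewrite cD.
  (* An edge tops a square with bottom [set0], where [e] is normalised to 1 on both ends. *)
  have := e_diamond (cell A) (cell (A :\ p)) (cell (A :\ q)) set0.
  rewrite !vert // !mulr1 vA vAp vAq /= -intrD => -> //.
  + exact: inX.
  + exact: neqD.
  + exact: facetD.
  + exact: facetD.
  + by rewrite -(box_cell0 R n d_gt0); apply/is_facet_cell0 => //; apply: cD.
  + by rewrite -(box_cell0 R n d_gt0); apply/is_facet_cell0 => //; apply: cD.
Qed.

(** The deleted pair is determined by the two boxes, so the sum has at most one term and spares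
    choosing that pair. *)
Definition cell_incidence F G : int :=
  let A := box_of F in let B := box_of G in
  if A == box0 then 0 else
  if B == box0 then (#|A| == d)%:R else \sum_(p in A | B == A :\ p) box_sign A p.

Lemma cell_incidenceD A p : valid_box A -> p \in A -> valid_box (A :\ p) ->
  cell_incidence (cell A) (cell (A :\ p)) = box_sign A p.
Proof.
move=> vA pA vAp; rewrite /cell_incidence !box_ofK ?valid_face_box //.
rewrite !(negbTE (valid_box_neq0 _ _)) // (bigD1 p) ?pA ?eqxx //= big1 ?addr0 //.
by move=> q /andP[/andP[_ /eqP/(setD1_inj pA) ->]]; rewrite eqxx.
Qed.

Lemma cell_incidence0 A : valid_box A -> #|A| = d ->
  cell_incidence (cell A) (cell box0) = 1.
Proof.
move=> vA cA; rewrite /cell_incidence !box_ofK ?face_box0 ?valid_face_box //.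
by rewrite (negbTE (valid_box_neq0 _ _)) // eqxx cA eqxx.
Qed.

Lemma cell_incidenceP : incidence_function X cell_incidence.
Proof.
split.
- move=> _ _ /box_complexP-/(_ d_gt0)[A fA ->] /box_complexP-/(_ d_gt0)[B fB ->] fac.
  have vA : valid_box A.
    by case/orP: fA fac => [//|/eqP -> /(not_facet_of_cell0 d_gt0 fB)].
  case/orP: fB fac => [vB /is_facet_cell|/eqP -> /is_facet_cell0].
    by move=> /(_ d_gt0 vA vB)[p pA eB]; rewrite eB in vB *;
      rewrite cell_incidenceD //; apply: box_sign_sqr.
  by move=> /(_ d_gt0 vA) cA; left; apply: cell_incidence0.
- move=> _ _ /box_complexP-/(_ d_gt0)[A fA ->] /box_complexP-/(_ d_gt0)[B fB ->] nfac.
  rewrite /cell_incidence !box_ofK //; case: eqP => // /eqP A0.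
  have vA : valid_box A by case/orP: fA A0 => // /eqP ->; rewrite eqxx.
  case: eqP => [B0|/eqP B0].
    case: eqP => // cA; case: nfac; rewrite B0; exact/is_facet_cell0.
  have vB : valid_box B by case/orP: fB B0 => // /eqP ->; rewrite eqxx.
  apply: big1 => p /andP[pA /eqP eB]; case: nfac.
  by apply/is_facet_cell => //; exists p.
- move=> P /verticesP-/(_ d_gt0)[A [vA cA ->]].
  by rewrite -(box_cell0 R n d_gt0) cell_incidence0.
- move=> F F1 F2 G; case/box_complexP => // A fA -> F12 fac1 fac2.
  have [inF1 inF2] : F1 \in X /\ F2 \in X.
    by split; [case: fac1 | case: fac2] => h _; apply: faces_in_complex h => //;
      apply: cell_in_complex.
  case/box_complexP: inF1 F12 fac1 => // B1 fB1 -> F12 fac1.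
  case/box_complexP: inF2 F12 fac2 => // B2 fB2 -> F12 fac2.
  have vA : valid_box A.
    by case/orP: fA fac1 => [//|/eqP -> /(not_facet_of_cell0 d_gt0 fB1)].
  move=> g1 g2; have inG : G \in X.
    by case: g1 => h _; apply: faces_in_complex h => //; apply: cell_in_complex.
  case/box_complexP: inG g1 g2 => // C fC -> g1 g2.
  have vB1 : valid_box B1.
    by case/orP: fB1 g1 => [//|/eqP -> /(not_facet_of_cell0 d_gt0 fC)].
  have vB2 : valid_box B2.
    by case/orP: fB2 g2 => [//|/eqP -> /(not_facet_of_cell0 d_gt0 fC)].
  move/(is_facet_cell _ d_gt0 vA vB1): fac1 => [p pA e1].
  move/(is_facet_cell _ d_gt0 vA vB2): fac2 => [q qA e2].
  have pq : p != q by apply/eqP => epq; apply: F12; rewrite e1 e2 epq.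
  rewrite e1 in g1 vB1 *; rewrite e2 in g2 vB2 *.
  rewrite !(cell_incidenceD vA) //.
  case/orP: fC g1 g2 => [vC|/eqP ->].
    move=> /(is_facet_cell _ d_gt0 vB1 vC)[q' q'A eC] /(is_facet_cell _ d_gt0 vB2 vC)[p' p'A eC'].
    have qC : q \notin C by rewrite eC' !inE eqxx andbF.
    have pC : p \notin C by rewrite eC !inE eqxx andbF.
    have eq' : q' = q.
      by apply/eqP; move: qC;
        rewrite eC !inE qA [q == p]eq_sym (negbTE pq) /= andbT negbK eq_sym.
    have ep' : p' = p.
      by apply/eqP; move: pC; rewrite eC' !inE pA pq /= andbT negbK eq_sym.
    rewrite eq' in eC; rewrite ep' in eC'.
    have -> : cell_incidence (cell (A :\ p)) (cell C) = box_sign (A :\ p) q.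
      rewrite eC; apply: cell_incidenceD => //; last by rewrite -eC.
      by rewrite in_setD1 eq_sym pq.
    have -> : cell_incidence (cell (A :\ q)) (cell C) = box_sign (A :\ q) p.
      rewrite eC'; apply: cell_incidenceD => //; last by rewrite -eC'.
      by rewrite in_setD1 pq.
    exact: box_sign_diamond.
  move=> /(is_facet_cell0 _ d_gt0 vB1) c1 /(is_facet_cell0 _ d_gt0 vB2) c2.
  rewrite !cell_incidence0 // !mulr1.
  have cA : #|A| = d.+1 by rewrite (cardsD1 p) pA c1.
  have /andP[sA fullA] := vA.
  (* In different rows, [q] would remain removable from [A :\ p], leaving a valid box with fewer
     than [d] elements. *)
  have epq : p.1 = q.1.
    apply/eqP/negPn/negP => npq.
    have /facet_pointsP[_ [r rA [rq er]]] : q \in facet_points A by rewrite -valid_boxD1.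
    have : valid_box (A :\ p :\ q).
      rewrite valid_boxD1 //; last by rewrite in_setD1 eq_sym pq.
      apply/facet_pointsP; split; first by rewrite in_setD1 eq_sym pq.
      exists r => //; rewrite in_setD1 rA andbT.
      by apply: contraNneq npq => <-; rewrite er.
    move/card_valid_box; have := c1; rewrite (cardsD1 q) in_setD1 eq_sym pq qA /=.
    by clear; lia.
  have := box_sign_edge sA fullA cA.
  case: (ltngtP p.2 q.2) => [lt|lt|/val_inj e].
  - by move=> /(_ p q pA qA epq lt)[-> ->].
  - by move=> /(_ q p qA pA (esym epq) lt)[-> ->].
  - by case/eqP: pq; rewrite [p]surjective_pairing [q]surjective_pairing epq e.
Qed.

End Incidence.

(** * The cellular resolution *)

Section Resolution.
Variables (R : realType) (K : fieldType) (d n : nat).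
Hypothesis d_gt0 : (0 < d)%N.
Local Notation box := {set 'I_d * 'I_n}.
Local Notation V := 'rV[R]_n.
Local Notation S := {mpoly K[n]}.
Local Notation bcell := (@box_cell R d n).
Local Notation X := (box_complex R d n).
Local Notation box_of := (@box_of R d n).
Local Notation lab := (@vertex_label R d n).
Implicit Types (A B : box).

Lemma sum_cells (W : nmodType) i (H : set V -> W) :
  \sum_(F : cell X i) H (cell_set F) =
  \sum_(A : box | valid_box A && (#|A| == i + d)%N) H (bcell A).
Proof.
transitivity (\sum_(F <- [seq cell_set F | F <- enum {: cell X i}]) H F).
  by rewrite big_map big_enum.
transitivity (\sum_(F <- [seq bcell A | A <- enum
    [pred A : box | valid_box A && (#|A| == i + d)%N]]) H F); last first.
  by rewrite big_map big_enum.
apply/perm_big/uniq_perm.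
- by rewrite map_inj_uniq ?enum_uniq // => F G /val_inj/val_inj.
- rewrite map_inj_in_uniq ?enum_uniq // => A B.
  by rewrite !mem_enum !inE => /andP[vA _] /andP[vB _]; apply: cell_inj.
move=> F; apply/mapP/mapP => [[[G /= dG] _ ->]|[A]].
  have [A fA eA] := elimT (box_complexP d_gt0 _) (valP G).
  by exists A => //; rewrite mem_enum inE -(affdim_cellE R _ _ fA) // -eA.
rewrite mem_enum inE => h ->; have /andP[vA _] := h.
have fA := valid_face_box vA.
have inA := cell_in_complex R d_gt0 fA.
have dA : affdim (val [` inA]%fset) == i%:Z by rewrite /= affdim_cellE.
by exists (exist _ [` inA]%fset dA); rewrite ?mem_enum.
Qed.

Lemma box_of_cell i (F : cell X i) :
  [/\ valid_box (box_of (cell_set F)), #|box_of (cell_set F)| = (i + d)%N &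
      bcell (box_of (cell_set F)) = cell_set F].
Proof.
have [A fA eA] := elimT (box_complexP d_gt0 _) (valP (val F)).
have eF : cell_set F = bcell A := eA.
have : affdim (cell_set F) == i%:Z := valP F.
by rewrite eF box_ofK // affdim_cellE // => /andP[vA /eqP].
Qed.

Variable e : set V -> set V -> int.
Hypothesis e_inc : incidence_function X e.

Definition box_eps A B : K :=
  if valid_box A && valid_box B then (e (bcell A) (bcell B))%:~R else 0.

Lemma box_eps_inc : box_incidence box_eps.
Proof. exact: incidence_box. Qed.

Definition chain_of i (w : box -> S) : chain K n X i := [ffun F =>
  w (box_of (cell_set F))].

(** Extension by zero: at most one cell has box [A]. *)
Definition box_chain i (f : chain K n X i) A : S :=
  \sum_(F : cell X i | box_of (cell_set F) == A) f F.

Lemma box_chainE i (f : chain K n X i) F : box_chain f (box_of (cell_set F)) = f F.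
Proof.
rewrite /box_chain (big_pred1 F) // => G; apply/eqP/eqP => [h|->//].
apply: val_inj; apply: val_inj; have [_ _ eF] := box_of_cell F.
by have [_ _ eG] := box_of_cell G; rewrite -[LHS]eG h eF.
Qed.

Lemma chain_of_box_chain i (f : chain K n X i) : chain_of i (box_chain f) = f.
Proof. by apply/ffunP => F; rewrite ffunE box_chainE. Qed.

Lemma box_chain_supp i (f : chain K n X i) A :
  box_chain f A != 0 -> valid_box A /\ #|A| = (i + d)%N.
Proof.
have [/existsP[F /eqP <-] _|/existsPn h] :=
  boolP [exists F : cell X i, box_of (cell_set F) == A].
  by have [? ? _] := box_of_cell F.
by rewrite /box_chain big_pred0 ?eqxx // => F; apply/negbTE.
Qed.

Lemma twist_supp A B : twist box_eps A B != 0 ->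
  [/\ valid_box A, valid_box B & #|A| = #|B|.+1].
Proof.
move=> nz; have : box_eps A B != 0.
  by apply: contraNneq nz => h; rewrite /twist h mpolyC0 mul0r.
move=> /(box_inc_facet box_eps_inc)[vA vB [p pA eB]]; rewrite eB in vB *; split=> //.
by rewrite (cardsD1 p) pA.
Qed.

Lemma bdry_coef_cell A B : valid_box A -> valid_box B ->
  bdry_coef K X lab e (bcell A) (bcell B) = twist box_eps A B.
Proof.
move=> vA vB; rewrite /bdry_coef /twist /box_eps vA vB /=.
by rewrite !label_cell ?valid_face_box // rmorph_int.
Qed.

Lemma bdry_chain_of i (w : box -> S) (G : cell X i) :
  bdry lab e (chain_of i.+1 w) G = \sum_A w A * twist box_eps A (box_of (cell_set G)).
Proof.
have [vG cG eG] := box_of_cell G; rewrite ffunE.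
under eq_bigr => F _ do rewrite ffunE.
rewrite (sum_cells _ (fun F => w (box_of F) * bdry_coef K X lab e F (cell_set G))).
rewrite [RHS](bigID (fun A : box => valid_box A && (#|A| == i.+1 + d)%N)) /=.
rewrite [X in _ = _ + X]big1 ?addr0 => [|A nA].
  apply: eq_bigr => A /andP[vA _].
  by rewrite box_ofK ?valid_face_box // -{1}eG bdry_coef_cell.
have [->|/twist_supp[vA _ cA]] := eqVneq (twist box_eps A (box_of (cell_set G))) 0.
  by rewrite mulr0.
by rewrite vA cA cG addSn eqxx in nA.
Qed.

Lemma augmentation_chain_of (w : box -> S) :
  augmentation lab (chain_of 0 w) =
  \sum_(A : box | valid_box A && (#|A| == d)) w A * 'X_[box_label A].
Proof.
rewrite /augmentation; under eq_bigr => F _ do rewrite ffunE.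
rewrite (sum_cells _ (fun F => w (box_of F) * 'X_[label X lab F])).
by apply: eq_bigr => A /andP[vA _]; rewrite box_ofK ?label_cell ?valid_face_box.
Qed.

Lemma augmentation_box_chain (f : chain K n X 0) :
  augmentation lab f = \sum_(A : box | #|A| == d) box_chain f A * 'X_[box_label A].
Proof.
rewrite -{1}[f]chain_of_box_chain augmentation_chain_of [RHS](bigID (@valid_box d n)) /=.
rewrite [X in _ = _ + X]big1 ?addr0 => [|A /andP[_ nv]].
  by apply: eq_bigl => A; rewrite andbC.
have [->|/box_chain_supp[]] := eqVneq (box_chain f A) 0; first by rewrite mul0r.
by rewrite (negbTE nv).
Qed.

(** The solution [w] may have components in every dimension; [chain_of i.+1] keeps those whose
    boundary reaches dimension [i]. *)
Lemma cycle_is_boundary i (f : chain K n X i) :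
  (forall B, valid_box B -> \sum_A box_chain f A * twist box_eps A B = 0) ->
  \sum_(A : box | #|A| == d) box_chain f A * 'X_[box_label A] = 0 ->
  exists g, bdry lab e g = f.
Proof.
move=> cyc aug.
have [A nz|w hw] := twist_acyclic box_eps_inc (f := box_chain f) _ cyc aug.
  by have [] := box_chain_supp nz.
by exists (chain_of i.+1 w); apply/ffunP => G; rewrite bdry_chain_of -hw box_chainE.
Qed.

Lemma cell_of_box i A : valid_box A -> #|A| = (i + d)%N ->
  exists F : cell X i, box_of (cell_set F) = A.
Proof.
move=> vA cA; have fA := valid_face_box vA; have inA := cell_in_complex R d_gt0 fA.
have dA : affdim (val [` inA]%fset) == i%:Z by rewrite /= affdim_cellE // vA cA /=.
by exists (exist _ [` inA]%fset dA); rewrite /cell_set /= box_ofK.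
Qed.

Lemma bdryE i (g : chain K n X i.+1) :
  bdry lab e g = chain_of i (fun B => \sum_A box_chain g A * twist box_eps A B).
Proof.
by apply/ffunP => G; rewrite -{1}[g]chain_of_box_chain bdry_chain_of [RHS]ffunE.
Qed.

Lemma bdry_bdry i (g : chain K n X i.+2) : bdry lab e (bdry lab e g) = 0.
Proof.
apply/ffunP => G; rewrite (bdryE g) bdry_chain_of [RHS]ffunE.
under eq_bigr do rewrite mulr_suml.
rewrite exchange_big big1 // => A _; under eq_bigr do rewrite -mulrA.
by rewrite -mulr_sumr (twist_bdry2 box_eps_inc) mulr0.
Qed.

Lemma augmentation_bdry (g : chain K n X 1) : augmentation lab (bdry lab e g) = 0.
Proof.
rewrite bdryE augmentation_chain_of.
transitivity (\sum_(B : box | #|B| == d)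
    \sum_A box_chain g A * (twist box_eps A B * 'X_[box_label B])).
  rewrite [RHS](bigID (@valid_box d n)) /= [X in _ = _ + X]big1 ?addr0 =>
    [|B /andP[_ nB]].
    apply: eq_big => [B|B]; first by rewrite andbC.
    by move=> _; rewrite mulr_suml; apply: eq_bigr => A _; rewrite -[LHS]mulrA.
  apply: big1 => A _; have [->|/twist_supp[_]] := eqVneq (twist box_eps A B) 0.
    by rewrite mul0r mulr0.
  by rewrite (negbTE nB).
rewrite exchange_big big1 // => A _.
by rewrite -mulr_sumr (twist_vertices box_eps_inc) mulr0.
Qed.

Lemma augmentation_ideal : is_ideal (range (@augmentation R n K n X lab)).
Proof.
split.
- by exists 0 => //; rewrite /augmentation big1 // => F _; rewrite ffunE mul0r.
- move=> _ _ [f _ <-] [g _ <-]; exists (f + g) => //.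
  by rewrite /augmentation -big_split; apply: eq_bigr => F _; rewrite ffunE mulrDl.
- move=> a _ [f _ <-]; exists [ffun F => a * f F] => //.
  by rewrite /augmentation mulr_sumr; apply: eq_bigr => F _; rewrite ffunE mulrA.
Qed.

Lemma range_augmentation :
  range (@augmentation R n K n X lab) = monomial_ideal (degree_monomials d).
Proof.
apply/seteqP; split.
  move=> _ [f _ <-]; rewrite augmentation_box_chain; apply: ideal_gen_sum => A /eqP cA.
  have [_ _ IM] := ideal_genP [set ('X_[m] : S) | m in @degree_monomials n d].
  by apply: IM; apply: monomial_ideal_mem; rewrite /degree_monomials /= mdeg_box_label.
apply: ideal_gen_min; first exact: augmentation_ideal.
move=> _ [m md <-]; have [g [vg lg]] := vertex_box_exists md.
exists (chain_of 0 (fun A => (A == sel_box g)%:R)) => //.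
rewrite augmentation_chain_of (bigD1 (sel_box g)) ?vg ?card_sel_box ?eqxx //=.
rewrite mul1r lg big1 ?addr0 // => A /andP[_ /negbTE ->].
by rewrite mul0r.
Qed.

Lemma box_complex_resolution :
  free_resolution X lab e (monomial_ideal (degree_monomials d) : set S).
Proof.
split; first exact: range_augmentation.
  apply/seteqP; split => [f /= aug0|_ [g _ <-]]; last exact: augmentation_bdry.
  have [||g <-] := cycle_is_boundary (f := f); last by exists g.
    (* A facet of a vertex box would have fewer than [d] elements, so the cycle condition is void in
       dimension 0. *)
    move=> B vB; apply: big1 => A _.
    have [->|/box_chain_supp[_ cA]] := eqVneq (box_chain f A) 0; first by rewrite mul0r.
    have [->|/twist_supp[_ _]] := eqVneq (twist box_eps A B) 0; first by rewrite mulr0.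
    by have := card_valid_box vB; rewrite cA add0n; move: #|_| => k; lia.
  by rewrite -augmentation_box_chain.
move=> i; apply/seteqP; split => [f /= bf|_ [g _ <-]]; last exact: bdry_bdry.
have [||g <-] := cycle_is_boundary (f := f); last by exists g.
  move=> B vB; have [cB|cB] := eqVneq #|B| (i + d)%N.
    have [G eG] := cell_of_box vB cB.
    have := congr1 (fun h : chain K n X i => h G) bf; rewrite bdryE !ffunE => h.
    by rewrite -[RHS]h eG.
  apply: big1 => A _.
  have [->|/box_chain_supp[_ cA]] := eqVneq (box_chain f A) 0; first by rewrite mul0r.
  have [->|/twist_supp[_ _]] := eqVneq (twist box_eps A B) 0; first by rewrite mulr0.
  by move=> h; case/eqP: cB; move: h; rewrite cA addSn => -[].
(* In positive dimension the augmentation condition is void: the chain vanishes on vertex boxes. *)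
apply: big1 => A /eqP cA.
have [->|/box_chain_supp[_]] := eqVneq (box_chain f A) 0; first by rewrite mul0r.
by rewrite cA; lia.
Qed.

Lemma box_complex_minimal : minimal_differential K X lab e.
Proof.
move=> i f G; rewrite ffunE; apply: ideal_gen_sum => F _.
have [_ _ IM] := ideal_genP [set ('X_i : S) | i in [set: 'I_n]].
have [I0 _ _] := ideal_genP [set ('X_i : S) | i in [set: 'I_n]].
apply: (IM).
have [vF _ <-] := box_of_cell F; have [vG _ <-] := box_of_cell G.
rewrite bdry_coef_cell //.
have [e0|] := eqVneq (box_eps (box_of (cell_set F)) (box_of (cell_set G))) 0.
  by rewrite /twist e0 mpolyC0 mul0r.
move=> /(box_inc_facet box_eps_inc)[_ _ [p pF eG]]; rewrite /twist.
apply: IM; rewrite eG (box_labelD1 pF) addmC addmK.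
by apply: sub_ideal_gen; exists p.2.
Qed.

End Resolution.

(** * Labels and subdivision *)

Section Subdivision.
Variables (R : realType) (d n : nat).
Hypothesis d_gt0 : (0 < d)%N.
Local Notation box := {set 'I_d * 'I_n}.
Local Notation V := 'rV[R]_n.
Local Notation bcell := (@box_cell R d n).
Local Notation X := (box_complex R d n).
Local Notation lab := (@vertex_label R d n).
Implicit Types (A B : box) (m : 'I_d -> 'I_n).

(** The label of a vertex is its coordinate vector, whence the injectivity of the labelling. *)
Lemma sel_pointE m v : sel_point R m 0 v = (box_label (sel_box m) v)%:R.
Proof.
rewrite mxE box_label_sel natr_sum; apply: eq_bigr => j _; by rewrite mxE.
Qed.

Lemma vertex_labelE A : valid_box A -> lab (bcell A) = box_label A.
Proof. by move=> vA; rewrite /vertex_label box_ofK // valid_face_box. Qed.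

Lemma vertices_sel P : vertices X P <->
  exists m, valid_box (sel_box m) /\ P = bcell (sel_box m).
Proof.
split=> [/(verticesP d_gt0)[A [vA cA ->]]|[m [vm ->]]].
  have [m mA _] := valid_box_sel vA.
  by exists m; rewrite -(card_full_box_sel mA cA).
by apply/verticesP => //; exists (sel_box m); rewrite card_sel_box.
Qed.

Lemma box_complex_labelled (K : fieldType) :
  labelled_by_generators X lab
    (monomial_ideal (degree_monomials d) : set {mpoly K[n]}).
Proof.
exists (degree_monomials d); first exact: min_generators_degree.
split.
- move=> P /vertices_sel[m [vm ->]].
  by rewrite /degree_monomials /= vertex_labelE // mdeg_box_label card_sel_box.
- move=> P Q; rewrite !inE => /vertices_sel[m [vm ->]] /vertices_sel[m' [vm' ->]].
  rewrite !vertex_labelE // => e; rewrite !cell_sel_box; congr [set _].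
  by apply/rowP => v; rewrite !sel_pointE e.
- move=> l /= dl; have [g [vg lg]] := vertex_box_exists dl.
  by exists (bcell (sel_box g)); [apply/vertices_sel; exists g | rewrite vertex_labelE].
Qed.

Definition corner (i : 'I_n) : V := sel_point R (fun _ : 'I_d => i).

Lemma cornerE i v : corner i 0 v = (v == i)%:R * d%:R.
Proof.
by rewrite sel_pointE box_label_sel sum_nat_const card_ord natrM mulrC.
Qed.

Lemma box_complex_subdivides : subdivides_power_simplex d X lab.
Proof.
have d0 : d%:R != 0 :> R by rewrite pnatr_eq0 -lt0n.
have sumc (a : 'I_n -> R) v : (\sum_i a i *: corner i) 0 v = a v * d%:R.
  rewrite summxE (bigD1 v) //= big1 ?addr0 => [|i iv]; rewrite mxE cornerE.
    by rewrite eqxx mul1r.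
  by rewrite eq_sym (negbTE iv) mul0r mulr0.
exists corner; split.
- move=> a _ a0 i; have := sumc a i; rewrite a0 mxE => /esym/eqP.
  by rewrite mulf_eq0 (negbTE d0) orbF => /eqP.
- apply/seteqP; split => [x [F /= /(box_complexP d_gt0)[A fA ->] xA]|_ [a [a0 a1 ->]]].
    exists (fun v => x 0 v / d%:R); split.
    + by move=> v; rewrite divr_ge0 ?ler0n ?(cell_ge0 _ xA).
    + by rewrite -mulr_suml (cell_sum xA) divff.
    + by apply/rowP => v; rewrite sumc divfK.
  set x := \sum_i _; have x0 v : 0 <= x 0 v by rewrite sumc mulr_ge0.
  have x1 : \sum_v x 0 v = d%:R by under eq_bigr do rewrite sumc;
    rewrite -mulr_suml a1 mul1r.
  exists (bcell (support_box (canon_coords d x))); last exact: support_canon_cell.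
  exact/cell_in_complex/valid_face_box/valid_support_canon.
- move=> i; have vi : valid_box (sel_box (fun _ : 'I_d => i)) := valid_const_box d i.
  rewrite /corner -cell_sel_box; split; first exact/cell_in_complex/valid_face_box.
  rewrite vertex_labelE //; apply/mnmP => v.
  by rewrite box_label_sel sum_nat_const card_ord mulmnE mnm1E eq_sym mulnC.
Qed.

End Subdivision.

(** * Shellings *)

Section BoundaryShelling.
Variables (R : realType) (d n : nat).
Hypothesis d_gt0 : (0 < d)%N.
Local Notation box := {set 'I_d * 'I_n}.
Local Notation V := 'rV[R]_n.
Local Notation bcell := (@box_cell R d n).
Local Notation box0 := (finset.set0 : box).
Implicit Types (A B E : box) (p q v w : 'I_d * 'I_n).

Lemma boundary_cellP A F : valid_box A ->
  boundary_complex (bcell A) F <-> exists B, [/\ face_box B, B \proper A & F = bcell B].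
Proof.
move=> vA; have fA := valid_face_box vA; split=> [[FA neA]|[B [fB pBA ->]]].
  have [B fB eF] : exists2 B, face_box B & F = bcell B.
    by apply/(box_complexP d_gt0); apply: faces_in_complex FA => //;
      apply: cell_in_complex.
  exists B; split=> //; rewrite finset.properEneq; apply/andP; split.
    by apply/eqP => e; apply: neA; rewrite eF e.
  by apply/(is_face_cell R) => //; rewrite -eF.
move: pBA; rewrite finset.properEneq => /andP[/eqP neBA BA]; split.
  exact/is_face_cell.
by move/face_cell_inj => /(_ fB fA).
Qed.

Definition facet_cell A p : set V := bcell (A :\ p).

Lemma facet_cell_inj A p q : valid_box A -> p \in facet_points A -> q \in facet_points A ->
  facet_cell A p = facet_cell A q -> p = q.
Proof.
move=> vA pF qF e; have pA := facet_points_sub pF; have qA := facet_points_sub qF.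
by apply: (setD1_inj pA); apply: cell_inj e; rewrite valid_boxD1.
Qed.

Lemma maximal_boundary A : valid_box A -> (d < #|A|)%N ->
  maximal_faces (boundary_complex (bcell A)) =
  [set facet_cell A p | p in [set p | p \in facet_points A]].
Proof.
move=> vA dA; apply/seteqP; split=> [F [bF maxF]|_ [p /= pF <-]].
  have [B [fB pBA eF]] := (boundary_cellP F vA).1 bF.
  have [vB|B0] := boolP (valid_box B).
    move: pBA => /properP[BA [p pA pB]].
    have BAp : B \subset A :\ p by rewrite subsetD1 BA pB.
    have vAp : valid_box (A :\ p) := valid_between vB BAp (subD1set _ _) vA.
    exists p; first by rewrite /= -valid_boxD1.
    apply: maxF; last by rewrite eF; apply: cellS.
    apply/boundary_cellP => //; exists (A :\ p); split=> //; first exact: valid_face_box.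
    exact: properD1.
  (* The empty face lies in any facet, and positive dimension provides one. *)
  have [p [_ [pF _ _ _]]] := facet_points_row vA dA.
  have vAp : valid_box (A :\ p) by rewrite valid_boxD1 // (facet_points_sub pF).
  exists p => //; apply: maxF.
    apply/boundary_cellP => //; exists (A :\ p); split=> //; first exact: valid_face_box.
    exact/properD1/(facet_points_sub pF).
  move: fB; rewrite /face_box (negbTE B0) /= => /eqP e.
  by rewrite eF e box_cell0.
have pA := facet_points_sub pF; have vAp : valid_box (A :\ p) by rewrite valid_boxD1.
split; first by apply/boundary_cellP => //; exists (A :\ p); split;
  rewrite ?valid_face_box ?properD1.
move=> G /(boundary_cellP _ vA)[B [fB pBA ->]] sub; congr box_cell.
have BA := proper_sub pBA; have /andP[_ /negP nAB] := pBA.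
have ApB := cell_subset vAp (face_box_sorted fB) sub.
apply/eqP; rewrite finset.eqEsubset ApB andbT subsetD1 BA /=.
apply/negP => pB; apply: nAB;
  rewrite -(finset.setD1K pA) finset.subUset finset.sub1set pB.
exact: ApB.
Qed.

(* A set of facets that is neither empty nor everything on some row of [A]
   covers a ball; the boundary of [A] itself is a sphere. *)
Definition shellable_facets A E : Prop :=
  E \subset facet_points A /\
  (E = facet_points A \/
   exists v w, [/\ v \in E, w \in facet_points A :\: E & v.1 = w.1]).

Definition shells_initially k A E : Prop :=
  exists (t : seq (set V)) (r : nat), shelling k (boundary_complex (bcell A)) t /\
    [set` take r t] = [set facet_cell A p | p in [set p | p \in E]].

(** A predicate in [k], so that it can serve as the induction hypothesis of its own proof by way of
    [shells_facets]. *)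
Definition shells_from_row_to_row k : Prop := forall A v w u,
  valid_box A -> #|A| = (k.+1 + d)%N -> v.1 = w.1 ->
  uniq (v :: rcons u w) -> v :: rcons u w =i facet_points A ->
  shelling k (boundary_complex (bcell A)) [seq facet_cell A p | p <- v :: rcons u w].

(** List [E] first, starting with [v], then the other facets, ending with [w]. If [E] is everything,
    any two facets in one row can take the two ends. *)
Lemma shells_facets k A E : shells_from_row_to_row k ->
  valid_box A -> #|A| = (k.+1 + d)%N -> shellable_facets A E -> shells_initially k A E.
Proof.
move=> sh vA cA [EF good].
suff [t [r [sht tr]]] : exists t r,
    shelling k (boundary_complex (bcell A)) [seq facet_cell A p | p <- t] /\
    take r t =i E.
  exists [seq facet_cell A p | p <- t], r; split=> //.
  apply/seteqP; split=> [F /=|_ [p /= pE <-]].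
    by rewrite -map_take => /mapP[p pt ->]; exists p => //=; rewrite -tr.
  by rewrite -map_take; apply/mapP; exists p => //; rewrite tr.
suff [v [w [u [r [vw ut et tr]]]]] : exists v w u r,
    [/\ v.1 = w.1, uniq (v :: rcons u w), v :: rcons u w =i facet_points A &
        take r (v :: rcons u w) =i E].
  by exists (v :: rcons u w), r; split=> //; apply: sh.
case: good => [->|[v [w [vE wFE vw]]]].
  have [|v [w [vF wF vw evw]]] := facet_points_row vA; first by rewrite cA; lia.
  pose T := facet_points A :\ v :\ w.
  exists v, w, (enum T), (size (v :: rcons (enum T) w)).
  have e : v :: rcons (enum T) w =i facet_points A.
    move=> p; rewrite inE mem_rcons inE mem_enum !in_setD1.
    case: eqP => [->|_] /=; first by rewrite vF.
    by case: eqP => [->|_] //=; rewrite wF.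
  rewrite take_size; split=> //.
  by rewrite /= mem_rcons inE negb_or vw rcons_uniq !mem_enum enum_uniq !inE !eqxx !andbF.
move: wFE; rewrite finset.in_setD => /andP[wE wF].
have vF := fintype.subsetP EF _ vE.
have nvw : v != w by apply: contraNneq wE => <-.
pose T1 := E :\ v; pose T2 := (facet_points A :\: E) :\ w.
exists v, w, (enum T1 ++ enum T2), (size (v :: enum T1)).
have in12 p : (p \in enum T1 ++ enum T2) = [&& p != v, p != w & p \in facet_points A].
  rewrite mem_cat !mem_enum !finset.in_setD !finset.in_set1.
  have [pE|pE] := boolP (p \in E); rewrite ?andbT ?andbF ?orbF /=.
    by rewrite (fintype.subsetP EF) // andbT (_ : p != w) ?andbT //;
      apply: contraNneq wE => <-.
  by rewrite (_ : p != v) //; apply: contraNneq pE => ->.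
split=> //.
- rewrite /= mem_rcons inE negb_or nvw rcons_uniq !in12 !eqxx /= andbF /=.
  rewrite cat_uniq !enum_uniq andbT /=; apply/hasPn => p.
  by rewrite !mem_enum !inE => /and3P[_ pE _]; rewrite (negbTE pE) andbF.
- move=> p; rewrite inE mem_rcons inE in12.
  case: eqP => [->|_] /=; first by rewrite vF.
  by case: eqP => [->|_] //=; rewrite wF.
- rewrite rcons_cat -cat_cons take_size_cat // => p; rewrite inE mem_enum in_setD1.
  by case: eqP => [->|].
Qed.

Lemma facet_list A (t : seq ('I_d * 'I_n)) : valid_box A -> (d < #|A|)%N ->
  uniq t -> t =i facet_points A ->
  [/\ uniq [seq facet_cell A p | p <- t],
    [set` [seq facet_cell A p | p <- t]] = maximal_faces (boundary_complex (bcell A)) &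
    forall F, F \in [seq facet_cell A p | p <- t] -> affdim F = (#|A|.-1 - d)%N%:Z].
Proof.
move=> vA dA ut et; have tF p : p \in t -> p \in facet_points A by rewrite et.
split.
- by rewrite map_inj_in_uniq // => p q /tF pF /tF qF; apply: facet_cell_inj.
- rewrite maximal_boundary //; apply/seteqP; split=> [F /= /mapP[p pt ->]|_ [p /= pF <-]].
    by exists p => //=; rewrite -et.
  by apply/mapP; exists p; rewrite ?et.
- move=> _ /mapP[p /tF pF ->]; have pA := facet_points_sub pF.
  rewrite affdim_box_cell ?valid_boxD1 //; move: dA; rewrite (cardsD1 p) pA /=.
  by move: #|_| => k; lia.
Qed.

Lemma shellable_facets_all A : shellable_facets A (facet_points A).
Proof. by split=> //; left. Qed.

Lemma cellID1 A p q : sorted_box A ->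
  facet_cell A p `&` facet_cell A q = bcell (A :\ p :\ q).
Proof.
move=> sA; rewrite /facet_cell cellI ?(sorted_boxS (subD1set _ _) sA) //.
congr box_cell; apply/setP => r; rewrite !inE.
by case: (r \in A); rewrite ?andbF ?andbT // andbC.
Qed.

Lemma shells_initially_cup k A E D : shells_initially k A E ->
  D = \bigcup_(p in [set p | p \in E]) facet_cell A p ->
  exists (t : seq (set V)) (r : nat), shelling k (boundary_complex (bcell A)) t /\
    D = \bigcup_(G in [set` take r t]) G.
Proof.
move=> [t [r [sh tr]]] ->; exists t, r; split=> //.
by rewrite tr bigcup_image.
Qed.

Lemma shellable_facets_neq0 A E : valid_box A -> (d < #|A|)%N -> shellable_facets A E ->
  \bigcup_(p in [set p | p \in E]) facet_cell A p !=set0.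
Proof.
move=> vA dA [EF good]; have [p pE] : exists p, p \in E.
  case: good => [->|[p [_ [pE _ _]]]]; last by exists p.
  by have [p [_ [pF _ _ _]]] := facet_points_row vA dA; exists p.
have pF := fintype.subsetP EF _ pE.
have /andP[_ fAp] : valid_box (A :\ p) by rewrite valid_boxD1 ?(facet_points_sub pF).
by have [x xp] := cell_nonempty R fAp; exists x, p.
Qed.

(** Facet [p] meets the earlier ones in the facets of [A :\ p] given by earlier pairs. Before the
    last position, [v] and [w] keep each other removable in [A :\ p], with [v] earlier and [w] not,
    so the induction hypothesis applies. *)
Lemma shelling_facets k : shells_from_row_to_row k.
Proof.
elim: k => [|k IH] A v w u vA cA vw ut et; have dA : (d < #|A|)%N by rewrite cA; lia.
  have [un mx dm] := facet_list vA dA ut et; split=> // F /dm ->.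
  by rewrite cA /= add0n subnn.
have [un mx dm] := facet_list vA dA ut et; split=> //.
  by move=> F /dm ->; rewrite cA addSn /= addnK.
have sA := proj1 (andP vA); set t := v :: rcons u w in ut et *.
have tF p : p \in t -> p \in facet_points A by rewrite et.
have vAt p : p \in t -> valid_box (A :\ p).
  by move=> /tF pF; rewrite valid_boxD1 ?(facet_points_sub pF).
have cAt p : p \in t -> #|A :\ p| = (k.+1 + d)%N.
  by move=> /tF /facet_points_sub pA; move: cA; rewrite (cardsD1 p) pA => -[].
have vt : v \in t by rewrite inE eqxx.
split.
  have [t1 [r1 [h _]]] := shells_facets IH (vAt _ vt) (cAt _ vt) (shellable_facets_all _).
  by exists t1.
rewrite size_map => j /andP[j0 jt] D; pose p := nth v t j.
have pt : p \in t by apply: mem_nth.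
have ep : nth set0 [seq facet_cell A q | q <- t] j =
  facet_cell A p by rewrite (nth_map v).
pose E := [set q in facet_points (A :\ p) | q \in take j t]%SET.
have eD : D = \bigcup_(q in [set q | q \in E]) facet_cell (A :\ p) q.
  rewrite /D ep; apply/seteqP; split=> [x [xp [i iD]]|x [q qE xq]].
    have ij : (i < j)%N := iD.
    have it : (i < size t)%N := ltn_trans ij jt.
    rewrite (nth_map v) // => xi; have qt : nth v t i \in t by apply: mem_nth.
    have xpq : bcell (A :\ p :\ nth v t i) x by rewrite -cellID1.
    exists (nth v t i) => //=; rewrite inE -{2}(nth_take v ij) mem_nth ?size_take ?jt //.
    (* The point [x] shows that the cell of [A :\ p :\ q], with [q] the pair at position [i], is
       nonempty, so this box is full. *)
    rewrite andbT -valid_boxD1 ?vAt //.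
      apply/andP; split; first exact: sorted_boxS (subD1set _ _) (sorted_boxS (subD1set _ _) sA).
      by apply/negPn/negP => /(cell_not_full R) e; rewrite e in xpq.
    rewrite in_setD1 nth_uniq // ltn_eqF //=.
    exact/facet_points_sub/tF.
  have : q \in E := qE; rewrite inE => /andP[qF qt].
  have [xA xB] : (facet_cell A p `&` facet_cell A q) x by rewrite cellID1.
  split=> //; have ij : (index q t < j)%N by rewrite index_ltn.
  exists (index q t) => //; have qt' : q \in t := mem_take qt.
  by rewrite (nth_map v) ?nth_index ?index_mem.
have wF : w \in t by rewrite inE mem_rcons inE eqxx orbT.
have szt : size t = (size u).+2 by rewrite /= size_rcons.
have shE : shellable_facets (A :\ p) E.
  split; first by apply/fintype.subsetP => q; rewrite inE => /andP[].
  have neq_nth i : (i < size t)%N -> i != j -> nth v t i != p by move=> it;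
    rewrite nth_uniq.
  have w_last : w = nth v t (size u).+1 by rewrite /= nth_rcons ltnn eqxx.
  (* At the last position all other facets are earlier, so the whole boundary of the facet is
     met. *)
  have [jl|jl] := eqVneq j (size u).+1.
    left; apply/setP => q; rewrite inE; case: (boolP (q \in facet_points _)) => //= qF.
    have qt : q \in t by rewrite et; apply: facet_pointsS qF; apply: subD1set.
    have : q != w.
      rewrite w_last -jl; have := facet_points_sub qF.
      by rewrite in_setD1 => /andP[].
    move: qt; rewrite jl /t -rcons_cons mem_rcons inE => /orP[/eqP ->|];
      first by rewrite eqxx.
    by rewrite -cats1 take_size_cat.
  have j_lt : (j <= size u)%N by move: jt jl; rewrite szt; lia.
  have vp : v != p by apply: (neq_nth 0%N); rewrite ?szt // eq_sym -lt0n.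
  have wp : w != p by rewrite w_last; apply: neq_nth; rewrite ?szt // eq_sym.
  have nvw : v != w by move: ut; rewrite /t /= mem_rcons inE negb_or => /andP[/andP[]].
  have [vA' wA'] : v \in A :\ p /\ w \in A :\ p.
    by rewrite !in_setD1 vp wp (facet_points_sub (tF _ vt)) (facet_points_sub (tF _ wF)).
  right; exists v, w; split=> //.
    rewrite inE; apply/andP; split.
      by apply/facet_pointsP; split=> //; exists w => //; rewrite eq_sym.
    by case: (j) j0 => // j' _; rewrite /= inE eqxx.
  rewrite finset.in_setD; apply/andP; split; last first.
    by apply/facet_pointsP; split=> //; exists v.
  rewrite inE negb_and; apply/orP; right; apply/negP.
  have -> : take j t = take j (v :: u) by rewrite /t -rcons_cons -cats1 takel_cat //= ltnW.
  move=> /mem_take; move: ut; rewrite /t -rcons_cons rcons_uniq => /andP[wn _].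
  by rewrite (negbTE wn).
split.
  rewrite -/D eD; apply: shellable_facets_neq0 shE; first exact: vAt.
  by rewrite cAt //; lia.
by rewrite ep; apply: shells_initially_cup eD; apply: shells_facets => //;
  [apply: vAt | apply: cAt].
Qed.

Lemma boundary_shelling k A E : valid_box A -> #|A| = (k.+1 + d)%N ->
  shellable_facets A E -> shells_initially k A E.
Proof. exact/shells_facets/shelling_facets. Qed.

End BoundaryShelling.

(** * Lattice paths, their corners and flips *)

Section Paths.
Variables (d n : nat).
Local Notation box := {set 'I_d.+1 * 'I_n.+1}.
Local Notation path := {ffun 'I_d.+1 -> 'I_n.+1}.
Implicit Types (A B : box) (a b : path) (i j : 'I_d.+1) (v : 'I_n.+1) (p : 'I_d.+1 * 'I_n.+1).

(** [a j] is the last column of row [j]. Row [j] starts where row [j - 1] ends, row 0 starts in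
    column 0, and the last row must reach the last column for the box to be maximal. *)
Definition is_path a : bool :=
  [forall i : 'I_d.+1, forall j : 'I_d.+1, (i <= j)%N ==> (a i <= a j)%N] &&
    (a ord_max == ord_max).

Lemma is_pathP a : reflect
  ((forall i j, (i <= j)%N -> (a i <= a j)%N) /\ a ord_max = ord_max) (is_path a).
Proof.
apply: (iffP andP) => -[h1 /eqP h2]; split=> //.
  by move=> i j; apply/implyP/(forallP (forallP h1 i) j).
by apply/forallP => i; apply/forallP => j; apply/implyP/h1.
Qed.

Definition path_box a : box :=
  [set p : 'I_d.+1 * 'I_n.+1 | (p.2 <= a p.1)%N &&
    [forall i : 'I_d.+1, (i < p.1)%N ==> (a i <= p.2)%N]]%SET.

Lemma path_boxP a j v :
  reflect ((v <= a j)%N /\ forall i, (i < j)%N -> (a i <= v)%N) ((j, v) \in path_box a).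
Proof.
rewrite inE /=; apply: (iffP andP) => -[h1 h2]; split=> //.
  by move=> i; apply/implyP/(forallP h2 i).
by apply/forallP => i; apply/implyP/h2.
Qed.

Lemma path_box_top a j : is_path a -> (j, a j) \in path_box a.
Proof. by move=> /is_pathP[mono _]; apply/path_boxP; split=> // i /ltnW/mono. Qed.

Lemma path_box_valid a : is_path a -> valid_box (path_box a).
Proof.
move=> pa; apply/andP; split; last by apply/full_boxP => j; exists (a j);
  apply: path_box_top.
apply/sorted_boxP => -[i u] [j v] /path_boxP[ui _] /path_boxP[_ h] /= ij.
exact: leq_trans ui (h _ ij).
Qed.

(** The rank [p.1 + p.2] is a bijection onto its range: rank [r] is attained in the first row [j]
    with [r <= j + a j]. *)
Lemma card_path_box a : is_path a -> #|path_box a| = (n + d.+1)%N.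
Proof.
move=> pa; have /is_pathP[mono amax] := pa; have /andP[sa _] := path_box_valid pa.
have bound p : (p.1 + p.2 < n + d.+1)%N.
  by have := ltn_ord p.1; have := ltn_ord p.2; lia.
pose f p : 'I_(n + d.+1) := Ordinal (bound p).
have inj : {in path_box a &, injective f}.
  by move=> p q pa' qa [] /(sorted_box_rank_inj sa); apply.
rewrite -(card_in_imset inj) -[RHS]card_ord -cardsT; apply: eq_card => r.
rewrite [RHS]inE; apply/imsetP.
have ex : exists j : nat, (j <= d)%N && (r <= j + a (inord j))%N.
  exists d; rewrite leqnn /= (_ : inord d = ord_max); last first.
    by apply: val_inj; rewrite /= inordK.
  by rewrite amax /=; have := ltn_ord r; lia.
case: (ex_minnP ex) => j /andP[jd rj] jmin.
have prev (i : 'I_d.+1) : (i < j)%N -> (i + a i < r)%N.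
  move=> ij; rewrite ltnNge; apply/negP => h; have := jmin i.
  by rewrite -ltnS ltn_ord inord_val h => /(_ isT); rewrite leqNgt ij.
have mono_prev (i : 'I_d.+1) : (i < j)%N -> (a i + j <= r)%N.
  move=> ij; have j1 : (j.-1 < d.+1)%N by lia.
  have := prev (Ordinal j1); have := mono i (Ordinal j1) => /=; lia.
have jr : (j <= r)%N by case: (j) mono_prev => // j' /(_ ord0 isT); lia.
have an := ltn_ord (a (inord j)).
have vn : (r - j < n.+1)%N by lia.
exists (inord j, Ordinal vn); last by apply: val_inj; rewrite /= inordK //; lia.
apply/path_boxP; split=> /=; first by lia.
by move=> i; rewrite inordK // => /mono_prev; lia.
Qed.

Lemma path_box_sub_inj a b : is_path a -> is_path b -> path_box a \subset path_box b -> a = b.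
Proof.
move=> pa pb ab; have e : path_box a = path_box b.
  by apply/eqP; rewrite eqEcard ab !card_path_box /=.
apply/ffunP => j; apply: val_inj; apply/eqP; rewrite eqn_leq /=.
have /path_boxP[-> _] : (j, a j) \in path_box b by rewrite -e path_box_top.
by have /path_boxP[-> _] : (j, b j) \in path_box a by rewrite e path_box_top.
Qed.

(** The path of the row maxima works once its last row is stretched to the last column; sortedness
    places every row beyond the maxima of the earlier ones. *)
Lemma path_box_cover A : valid_box A -> exists2 a, is_path a & A \subset path_box a.
Proof.
move=> /andP[/sorted_boxP sA /full_boxP fA].
have top j : {w | (j, w) \in A & forall u, (j, u) \in A -> (u <= w)%N}.
  case: (arg_maxnP (P := fun u => (j, u) \in A) (fun u => u : nat) (xchooseP (fA j))).
  by move=> w jw hw; exists w.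
pose mu j := s2val (top j).
have muA j : (j, mu j) \in A := s2valP (top j).
have mu_max j u : (j, u) \in A -> (u <= mu j)%N := s2valP' (top j) u.
pose a : path := [ffun j => if j == ord_max then ord_max else mu j].
have mu_a j : (mu j <= a j)%N by rewrite ffunE; case: eqP => // _; rewrite -ltnS ltn_ord.
have a_mu i j u : (i < j)%N -> (j, u) \in A -> (a i <= u)%N.
  move=> ij ju; rewrite ffunE; case: eqP => [ei|_]; last exact: (sA _ _ (muA i) ju ij).
  by have := ltn_ord j; rewrite ei /= in ij; lia.
exists a.
  apply/is_pathP; split=> [i j|]; last by rewrite ffunE eqxx.
  rewrite leq_eqVlt => /orP[/eqP/val_inj -> //|ij].
  exact: leq_trans (a_mu _ _ _ ij (muA j)) (mu_a j).
apply/fintype.subsetP => -[j u] ju; apply/path_boxP; split.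
  exact: leq_trans (mu_max _ _ ju) (mu_a j).
by move=> i ij; apply: a_mu ij ju.
Qed.

Definition path_weight a : nat := (\sum_j a j)%N.

(** The turns where the path leaves a row with more than one element through its top; deleting such
    a turn gives a facet shared with a path of smaller area. *)
Definition path_corners a : box :=
  [set p in path_box a | [&& p.1 != ord_max, p.2 == a p.1 &
     [exists v : 'I_n.+1, (v < a p.1)%N && ((p.1, v) \in path_box a)]]]%SET.

Lemma path_cornersP a p : reflect
  [/\ p \in path_box a, p.1 != ord_max, p.2 = a p.1 &
      exists2 v : 'I_n.+1, (v < a p.1)%N &
        (p.1, v) \in path_box a] (p \in path_corners a).
Proof.
rewrite !inE; apply: (iffP and4P) => -[h1 h2 h3 h4]; split=> //.
- exact/eqP.
- by case/existsP: h4 => v /andP[? ?]; exists v.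
- exact/eqP.
- by case: h4 => v ? ?; apply/existsP; exists v; apply/andP.
Qed.

(** The weights force [b] below [a] somewhere. In the first such row [j], the top [(j, a j)] is
    missed by [b], and it is a corner because [(j, b j)] also belongs to the box of [a]. *)
Lemma path_corner_sep a b : is_path a -> is_path b -> (path_weight b <= path_weight a)%N ->
  b != a -> exists2 p, p \in path_corners a & p \notin path_box b.
Proof.
move=> pa pb wba nba; have /is_pathP[ma amax] := pa; have /is_pathP[mb bmax] := pb.
have [/existsP[j0 bad0]|/existsPn nbad] := boolP [exists j, (b j < a j)%N]; last first.
  have le j : (a j <= b j)%N by rewrite leqNgt.
  case/eqP: nba; apply/ffunP => j; apply: val_inj => /=.
  apply/eqP; rewrite eqn_leq le andbT leqNgt; apply/negP => lt.
  move: wba; rewrite /path_weight (bigD1 j) //= [leqRHS](bigD1 j) //=.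
  have : (\sum_(i | i != j) a i <= \sum_(i | i != j) b i)%N by apply: leq_sum.
  move=> h1 h2; have := leq_trans (leq_add lt h1) h2.
  by rewrite addSn ltnn.
case: (arg_minnP (P := fun j => (b j < a j)%N) (fun j => j : nat) bad0) => j bad jmin.
have good i : (i < j)%N -> (a i <= b i)%N.
  by move=> ij; rewrite leqNgt; apply/negP => /jmin; rewrite leqNgt ij.
have jm : j != ord_max by apply: contraTneq bad => ->; rewrite amax bmax ltnn.
exists (j, a j); last by apply/negP => /path_boxP[]; rewrite leqNgt bad.
apply/path_cornersP; split=> //=; first exact: path_box_top.
exists (b j) => //; apply/path_boxP; split; first exact: ltnW.
by move=> i ij; apply: leq_trans (good _ ij) (mb _ _ (ltnW ij)).
Qed.

(** Lowering [a j] by one trades the corner for the pair in the next row and the previous column. *)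
Lemma path_corner_flip a p : is_path a -> p \in path_corners a ->
  exists b, [/\ is_path b, (path_weight b < path_weight a)%N &
    path_box a :\ p \subset path_box b].
Proof.
move=> pa /path_cornersP[]; case: p => j u /= _ jm -> [v va /path_boxP[_ hv]].
have /is_pathP[ma amax] := pa.
have pred_lt : ((a j).-1 < n.+1)%N by have := ltn_ord (a j); lia.
pose b : path := [ffun i => if i == j then Ordinal pred_lt else a i].
have bj : b j = (a j).-1 :> nat by rewrite ffunE eqxx.
have bi i : i != j -> b i = a i by move=> ij; rewrite ffunE (negbTE ij).
have ba i : (b i <= a i)%N by have [->|/bi ->//] := eqVneq i j; rewrite bj leq_pred.
exists b; split.
- apply/is_pathP; split; last by rewrite bi 1?eq_sym.
  move=> i k; rewrite leq_eqVlt => /orP[/eqP/val_inj -> //|ik].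
  have [kj|/bi ->] := eqVneq k j.
    by rewrite kj bj; have := ba i; rewrite kj in ik; have := hv i ik; lia.
  exact: leq_trans (ba i) (ma _ _ (ltnW ik)).
- rewrite /path_weight (bigD1 j) //= [ltnRHS](bigD1 j) //= bj.
  rewrite (eq_bigr (fun i => a i : nat)) => [|i /bi -> //].
  by rewrite ltn_add2r; move: va; lia.
apply/fintype.subsetP => -[i w]; rewrite in_setD1 => /andP[ne /path_boxP[wi hw]].
apply/path_boxP; split.
  have [ij|/bi -> //] := eqVneq i j; rewrite ij bj; rewrite ij in wi ne.
  suff : w != a j :> nat by move: wi; lia.
  by apply: contraNneq ne => /val_inj ->; rewrite eqxx.
by move=> k ki; apply: leq_trans (ba k) (hw _ ki).
Qed.

End Paths.

(** [shelling] unfolds only for [k] in constructor form; this version treats all dimensions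
    together. *)
Lemma shelling_intro (R : realType) (N k : nat) (C : set (set 'rV[R]_N)) s :
  uniq s -> [set` s] = maximal_faces C -> (forall F, F \in s -> affdim F = k%:Z) ->
  (forall k', k = k'.+1 ->
    (exists t, shelling k' (boundary_complex (nth set0 s 0)) t) /\
    forall j : nat, (0 < j < size s)%N ->
      let D := nth set0 s j `&`
               \bigcup_(i in [set i : nat | (i < j)%N]) nth set0 s i in
      D !=set0 /\
      exists (t : seq (set 'rV[R]_N)) (r : nat),
        shelling k' (boundary_complex (nth set0 s j)) t /\
        D = \bigcup_(G in [set` take r t]) G) ->
  shelling k C s.
Proof. by case: k => [|k] u m a h; split=> //; apply: h. Qed.

Section ComplexShelling.
Variables (R : realType) (d n : nat).
Local Notation box := {set 'I_d.+1 * 'I_n.+1}.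
Local Notation V := 'rV[R]_n.+1.
Local Notation bcell := (@box_cell R d.+1 n.+1).
Local Notation X := (box_complex R d.+1 n.+1).
Local Notation path := {ffun 'I_d.+1 -> 'I_n.+1}.
Implicit Types (A B : box) (a b : path) (p q : 'I_d.+1 * 'I_n.+1).

Definition path_cell a : set V := bcell (path_box a).

Lemma path_cell_inj : {in @is_path d n &, injective path_cell}.
Proof.
move=> a b pa pb /cell_inj e; apply: path_box_sub_inj => //.
by rewrite e //; apply: path_box_valid.
Qed.

Lemma maximal_faces_complex :
  maximal_faces [set` X] = [set path_cell a | a in [set a | is_path a]].
Proof.
have d_gt0 : (0 < d.+1)%N by [].
apply/seteqP; split=> [F [XF maxF]|_ [a /= pa <-]].
  have [A fA eF] := elimT (box_complexP d_gt0 F) XF.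
  have cover B : valid_box B -> F `<=` bcell B -> exists2 a, is_path a & path_cell a = F.
    move=> vB FB; have [a pa Ba] := path_box_cover vB; exists a => //.
    apply: maxF; first exact/cell_in_complex/valid_face_box/path_box_valid.
    by apply: subset_trans FB _; apply: cellS.
  have [vA|A0] := boolP (valid_box A).
    by have [|a pa ea] := cover A vA; [rewrite eF | exists a].
  have [|a pa ea] := cover _ (valid_const_box d.+1 (ord0 : 'I_n.+1)); last by exists a.
  move: fA; rewrite /face_box (negbTE A0) /= => /eqP e.
  by rewrite eF e (box_cell0 R n.+1 d_gt0); apply: sub0set.
have va := path_box_valid pa.
split; first exact/cell_in_complex/valid_face_box.
move=> G XG; have [B fB ->] := elimT (box_complexP d_gt0 G) XG => sub.
have aB := cell_subset va (face_box_sorted fB) sub.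
have vB : valid_box B.
  case/orP: fB => // /eqP e; move: (valid_box_neq0 d_gt0 va).
  by rewrite -finset.subset0 -e aB.
have [b pb Bb] := path_box_cover vB.
have eab := path_box_sub_inj pa pb (fintype.subset_trans aB Bb).
congr box_cell; apply/eqP; rewrite finset.eqEsubset aB andbT.
by rewrite eab.
Qed.

(** A corner is the top of its row, so a lower element of that row is a facet that is not a
    corner. *)
Lemma corners_shellable a : is_path a -> path_corners a != finset.set0 ->
  shellable_facets (path_box a) (path_corners a).
Proof.
move=> pa; have facetP p v : p \in path_box a -> (p.1, v) \in path_box a -> v != p.2 ->
    p \in facet_points (path_box a).
  move=> pA vA vp; apply/facet_pointsP; split=> //; exists (p.1, v) => //.
  by split=> //; apply: contraNneq vp => <-.
have neq p (v : 'I_n.+1) : p.2 = a p.1 -> (v < a p.1)%N -> v != p.2.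
  by move=> -> lt; apply: contraTneq lt => ->; rewrite ltnn.
have sub : path_corners a \subset facet_points (path_box a).
  apply/fintype.subsetP => p /path_cornersP[pA _ ep [v lt vA]].
  exact: facetP vA (neq _ _ ep lt).
case/finset.set0Pn => p pC; split=> //; right.
have /path_cornersP[pA _ ep [v lt vA]] := pC.
exists p, (p.1, v); split=> //; rewrite finset.in_setD; apply/andP; split.
  by apply/negP => /path_cornersP[_ _ /= e _]; rewrite e ltnn in lt.
apply: (facetP _ p.2) => //=; first by rewrite -surjective_pairing.
by rewrite eq_sym; apply: neq.
Qed.

Lemma box_complex_shellable : shellable X.
Proof.
(* Ties may be broken arbitrarily: [path_corner_sep] asks only for a weak inequality of weights. *)
pose le a b := (path_weight a <= path_weight b)%N.
pose s := sort le (enum (@is_path d n)).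
have le_total : total le by move=> a b; apply: leq_total.
have le_trans : transitive le by move=> b a c; apply: leq_trans.
have us : uniq s by rewrite sort_uniq enum_uniq.
have ms a : (a \in s) = is_path a by rewrite mem_sort mem_enum.
have a0 : path := [ffun=> ord_max].
have nth_le i j : (i <= j)%N -> (j < size s)%N -> le (nth a0 s i) (nth a0 s j).
  move=> ij js; apply: (sorted_leq_nth le_trans (fun a => leqnn _)) => //.
  - exact: sort_sorted.
  - by rewrite inE (leq_ltn_trans ij).
have dim a : is_path a -> affdim (path_cell a) = n%:Z.
  move=> pa; rewrite affdim_box_cell ?card_path_box ?path_box_valid //; lia.
exists n, [seq path_cell a | a <- s]; apply: shelling_intro.
- by rewrite map_inj_in_uniq // => a b; rewrite !ms; apply: path_cell_inj.
- rewrite maximal_faces_complex; apply/seteqP; split=> [F /mapP[a]|_ [a /= pa <-]].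
    by rewrite ms => pa ->; exists a.
  by apply/mapP; exists a; rewrite ?ms.
- by move=> F /mapP[a]; rewrite ms => pa ->; apply: dim.
move=> k nk.
have shell a E : is_path a -> shellable_facets (path_box a) E -> shells_initially R k (path_box a) E.
  move=> pa; apply: boundary_shelling => //; first exact: path_box_valid.
  by rewrite card_path_box // nk.
split.
  have s_gt0 : (0 < size s)%N.
    have [a pa _] := path_box_cover (valid_const_box d.+1 (ord0 : 'I_n.+1)).
    by rewrite -ms in pa; case: (s) pa.
  rewrite (nth_map a0) //; have p0 : is_path (nth a0 s 0) by rewrite -ms mem_nth.
  by have [t [r [h _]]] := shell _ _ p0 (shellable_facets_all _); exists t.
rewrite size_map => j /andP[j0 js] D.
pose a := nth a0 s j; have pa : is_path a by rewrite -ms mem_nth.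
have ea : nth set0 [seq path_cell b | b <- s] j = path_cell a by rewrite (nth_map a0).
have before i : (i < j)%N -> exists b, [/\ nth set0 [seq path_cell b | b <- s] i =
  path_cell b,
    is_path b, le b a & b != a].
  move=> ij; have it := ltn_trans ij js; exists (nth a0 s i); split.
  - by rewrite (nth_map a0).
  - by rewrite -ms mem_nth.
  - exact: nth_le (ltnW ij) js.
  - by rewrite nth_uniq // ltn_eqF.
have va := path_box_valid pa; have sa := proj1 (andP va).
have corner_neq0 : path_corners a != finset.set0.
  have [b [_ pb ba nba]] := before 0%N j0.
  have [p pC _] := path_corner_sep pa pb ba nba.
  by apply/finset.set0Pn; exists p.
have shE := corners_shellable pa corner_neq0.
(* An earlier path misses some corner, so it meets [a] within that facet; conversely the flip at a
   corner has strictly smaller weight, hence comes earlier, and contains the facet. *)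
have eD : D = \bigcup_(p in [set p | p \in path_corners a]) facet_cell (path_box a) p.
  rewrite /D ea; apply/seteqP; split=> [x [xa [i iD]]|x [p pC xp]].
    have [b [-> pb ba nba]] := before i iD => xb.
    have [p pC npb] := path_corner_sep pa pb ba nba.
    exists p => //; have sb := proj1 (andP (path_box_valid pb)).
    have : bcell (path_box a :&: path_box b) x by rewrite -cellI.
    apply: cellS; apply/fintype.subsetP => q; rewrite finset.in_setI in_setD1 =>
      /andP[-> qb].
    by rewrite andbT; apply: contraNneq npb => <-.
  have [b [pb ltb sub]] := path_corner_flip pa pC.
  split; first by apply: cellS xp; apply: subD1set.
  exists (index b s); last first.
    by rewrite (nth_map a0) ?index_mem ?ms // nth_index ?ms //; apply: cellS xp.
  rewrite /= ltnNge; apply/negP => ji.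
  have := nth_le _ _ ji; rewrite index_mem ms pb nth_index ?ms // => /(_ isT).
  by rewrite /le leqNgt ltb.
have da : (d.+1 < #|path_box a|)%N by rewrite card_path_box // nk; lia.
split; first by rewrite -/D eD; apply: shellable_facets_neq0 shE.
by rewrite ea; apply: shells_initially_cup eD; apply: shell.
Qed.

End ComplexShelling.

Theorem theorem3p8 (R : realType) (K : fieldType) (n d : nat)
    (charK0 : [pchar K]%R =i pred0) (n_ge1 : (1 <= n)%N) (d_ge1 : (1 <= d)%N) :
  exists (N : nat) (X : {fset (set 'rV[R]_N)})
         (lab : set 'rV[R]_N -> 'X_{1..n}),
    [/\ polyhedral_cell_complex X,
        shellable X,
        supports_minimal_resolution X lab (ideal_exp (maxideal K n) d) &
        subdivides_power_simplex d X lab].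
Proof.
exists n, (box_complex R d n), (@vertex_label R d n); split.
- exact: box_complex_polyhedral.
- case: n n_ge1 => // n' _; case: d d_ge1 => // d' _; exact: box_complex_shellable.
- rewrite ideal_exp_maxideal; last first.
    move=> m md; have [g [_ <-]] := vertex_box_exists md.
    by exists g; apply: box_label_sel_sum.
  split; first exact: box_complex_labelled.
    by exists (@cell_incidence R d n); apply: cell_incidenceP.
  by move=> e einc; split; [apply: box_complex_resolution | apply: box_complex_minimal].
- exact: box_complex_subdivides.
Qed.
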